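(* Let $k\ge1$ and let $E$ be a $k$-instanton bundle on $\mathbb{P}^3=\mathbb{P}(V)$ over $\mathbb{C}$. If $\operatorname{length} Z_k(E)\ge 2$ (where $Z_k(E)$ is the scheme of jumping lines of order $k$; the condition includes the case $\dim Z_k(E)>0$), then $Sym^0(E)$ contains a subgroup $G$ of positive dimension having a fine action.
   Context: We work over $\mathbb{C}$, $\dim V=4$. A $k$-instanton bundle on $\mathbb{P}^3=\mathbb{P}(V)$ is a rank 2 vector bundle $E$ with $c_1(E)=0$, $c_2(E)=k$, $h^0(E)=0$, $h^1(E(-2))=0$. Monads: there are a vector space $I$ of dimension $k$ and a symplectic vector space $(W,J)$ of dimension $2k+2$ such that $E$ is the cohomology $\ker A/\operatorname{im}A^t$ of a monad $I^*\otimes\mathcal{O}(-1)\xrightarrow{A^t}W\otimes\mathcal{O}\xrightarrow{A}I\otimes\mathcal{O}(1)$, where $A^t$ is the transpose with respect to $J$. Here $A\in W\otimes I\otimes V=\operatorname{Hom}(W\otimes\mathcal{O},I\otimes\mathcal{O}(1))$ is surjective as a bundle map and satisfies $AJA^t=0$; one says $A$ represents $E$. It is unique up to the action of $GL(I)\times Sp(W)$. $Z_k(E)$: the scheme of lines $l\subset\mathbb{P}^3$ with $E_{|l}\simeq\mathcal{O}_l(-k)\oplus\mathcal{O}_l(k)$, a closed subscheme of the Grassmannian of lines in $\mathbb{P}^3$. Writing $A=\sum_{i=0}^3A_ix_i$ in homogeneous coordinates $x_0,\dots,x_3$, it is the subscheme of the Plücker quadric $p_{01}p_{23}-p_{02}p_{13}+p_{03}p_{12}=0$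 in $\mathbb{P}^5$ cut out by the linear equations $\sum_{i<j}p_{ij}A_iJA_j^t=0$. $Sym(E)=\{g\in SL(V): g^*E\simeq E\}$, and $Sym^0(E)$ is its connected component containing the identity. Fine action: a subgroup $G\subseteq GL(V)$ has a fine action if there are 2-dimensional vector spaces $U,U'$ and isomorphisms $V\simeq U\otimes U'$, $W\simeq S^kU\otimes U'$, $I\simeq S^{k-1}U$ such that $G\subseteq GL(U)\times GL(U')$ acts on $V$ via the first isomorphism and the action of $G$ on $MI_{\mathbb{P}^3}(k)$ (the moduli space of $k$-instanton bundles) lifts to the action of $G$ on $W\otimes I\otimes V$ determined by the three isomorphisms ($G$ acting on $W$ through $Sp(W)$). For $G\subseteq Sym(E)$ this means that the lifted action fixes some $A$ representing $E$. *)

(* Defs.v *)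
From HB Require Import structures.
From mathcomp Require Import all_boot all_order all_algebra.
From mathcomp Require Export reals.
From mathcomp.real_closed Require Export complex mxtens.
From mathcomp Require Export mpoly.

Set Implicit Arguments.
Unset Strict Implicit.
Unset Printing Implicit Defensive.

Import Order.TTheory GRing.Theory Num.Theory.
Local Open Scope ring_scope.

(* Conventions.  V = C^4 is the space of linear forms, with basis the
   homogeneous coordinates x_0, ..., x_3 of P^3; vectors of V are columns.
   A point of P^3 is given by a nonzero row vector x, and g in GL(V) acts on
   points by x |-> x *m g, so that the form with coordinates v, evaluated at
   x *m g, is the form g *m v evaluated at x.
   Varieties are classical: functions on subsets of P^3 are functions on the
   corresponding cones in C^4, and their values outside the domain under
   consideration are irrelevant. *)

(* h is, on the open cone D, a regular homogeneous function of degree n, i.e. a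
   section of O(n): near each point it is a quotient of homogeneous polynomials
   whose degrees differ by n. *)
Definition regular_fun (C : fieldType) (D : 'rV[C]_4 -> Prop) (n : int)
    (h : 'rV[C]_4 -> C) : Prop :=
  forall x0, D x0 ->
  exists (d e : nat) (P Q : {mpoly C[4]}),
    [/\ d%:Z = e%:Z + n, P \is d.-homog, Q \is e.-homog, Q.@[x0 0] != 0
      & forall x, D x -> Q.@[x 0] != 0 -> h x = P.@[x 0] / Q.@[x 0]].

Definition regular_mx (C : fieldType) (D : 'rV[C]_4 -> Prop) (n : int)
    (p q : nat) (M : 'rV[C]_4 -> 'M[C]_(p, q)) : Prop :=
  forall i j, regular_fun D n (fun x => M x i j).

(* Vector bundles of rank r are given by transition matrices on a finite cover
   of P^3 by principal affine open sets f_i != 0; trans i j maps the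
   trivialization over the j-th set to the one over the i-th set. *)
Record bundle_data (C : fieldType) (r : nat) := BundleData {
  nchart : nat;
  chart : 'I_nchart -> {mpoly C[4]};
  trans : 'I_nchart -> 'I_nchart -> 'rV[C]_4 -> 'M[C]_r }.

Definition dom (C : fieldType) (r : nat) (E : bundle_data C r)
    (i : 'I_(nchart E)) (x : 'rV[C]_4) : Prop := (chart i).@[x 0] != 0.

Definition dom2 (C : fieldType) (r : nat) (E : bundle_data C r)
    (i j : 'I_(nchart E)) (x : 'rV[C]_4) : Prop := dom i x /\ dom j x.

Record is_bundle (C : fieldType) (r : nat) (E : bundle_data C r) : Prop := {
  chart_homog : forall i : 'I_(nchart E),
    exists2 d : nat, (0 < d)%N & chart i \is d.-homog;
  chart_cover : forall x : 'rV[C]_4, x != 0 ->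
    exists i : 'I_(nchart E), dom i x;
  trans_regular : forall i j : 'I_(nchart E),
    regular_mx (dom2 i j) 0 (trans i j);
  trans_id : forall (i : 'I_(nchart E)) x, dom i x -> trans i i x = 1%:M;
  trans_cocycle : forall (i j l : 'I_(nchart E)) x,
    dom i x -> dom j x -> dom l x ->
    trans i j x *m trans j l x = trans i l x }.

Definition bundle_iso (C : fieldType) (r : nat) (E F : bundle_data C r) : Prop :=
  exists Psi : 'I_(nchart F) -> 'I_(nchart E) -> 'rV[C]_4 -> 'M[C]_r,
    [/\ forall j i, regular_mx (fun x => dom j x /\ dom i x) 0 (Psi j i),
        forall j i x, dom j x -> dom i x -> Psi j i x \in unitmx
      & forall j j' i i' x, dom j x -> dom j' x -> dom i x -> dom i' x ->
          trans j' j x *m Psi j i x = Psi j' i' x *m trans i' i x].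

(* g^* E *)
Definition pull (C : fieldType) (r : nat) (g : 'M[C]_4) (E : bundle_data C r) :
    bundle_data C r :=
  @BundleData C r (nchart E)
    (fun i => chart i \mPo [tuple \sum_(l < 4) g l m *: 'X_l | m < 4])
    (fun i j x => trans i j (x *m g)).

Definition is_section (C : fieldType) (r : nat) (E : bundle_data C r) (n : int)
    (s : 'I_(nchart E) -> 'rV[C]_4 -> 'cV[C]_r) : Prop :=
  (forall i, regular_mx (dom i) n (s i)) /\
  (forall i j x, dom i x -> dom j x -> s i x = trans i j x *m s j x).

(* h^0(E(n)) = N *)
Definition h0_eq (C : fieldType) (r : nat) (E : bundle_data C r) (n : int)
    (N : nat) : Prop :=
  exists s : 'I_N -> 'I_(nchart E) -> 'rV[C]_4 -> 'cV[C]_r,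
    (forall l, is_section n (s l)) /\
    (forall t : 'I_(nchart E) -> 'rV[C]_4 -> 'cV[C]_r, is_section n t ->
     exists! c : 'rV[C]_N,
       forall i x, dom i x -> t i x = \sum_(l < N) c 0 l *: s l i x).

(* h^1(E(n)) = 0, computed on the affine cover: every Cech 1-cocycle of E(n) is a coboundary; the component
   c i j is written in the i-th trivialization. *)
Definition h1_eq0 (C : fieldType) (r : nat) (E : bundle_data C r) (n : int) :
    Prop :=
  forall c : 'I_(nchart E) -> 'I_(nchart E) -> 'rV[C]_4 -> 'cV[C]_r,
    (forall i j, regular_mx (dom2 i j) n (c i j)) ->
    (forall i j l x, dom i x -> dom j x -> dom l x ->
       c i l x = c i j x + trans i j x *m c j l x) ->
  exists s : 'I_(nchart E) -> 'rV[C]_4 -> 'cV[C]_r,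
    (forall i, regular_mx (dom i) n (s i)) /\
    (forall i j x, dom i x -> dom j x ->
       c i j x = trans i j x *m s j x - s i x).

(* c_1(E) = c1 means that det E is isomorphic to O(c1), i.e. that
   det E (- c1) has a nowhere vanishing section. *)
Definition c1_eq (C : fieldType) (r : nat) (E : bundle_data C r) (c1 : int) :
    Prop :=
  exists u : 'I_(nchart E) -> 'rV[C]_4 -> C,
    [/\ forall i, regular_fun (dom i) (- c1) (u i),
        forall i x, dom i x -> u i x != 0
      & forall i j x, dom i x -> dom j x ->
          u i x = \det (trans i j x) * u j x].

(* For a rank 2 bundle with c_1(E) = c1, the class c_2(E) is read off the
   Hilbert polynomial: h^0(E(n)) = chi(E(n)) for n >> 0, and Riemann-Roch on
   P^3 for E(n), whose Chern classes are a = c1 + 2n and b = c2 + c1 n + n^2,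
   gives 6 chi(E(n)) = a^3 - 3ab + 6a^2 - 12b + 11a + 12. *)
Definition c2_eq (C : fieldType) (E : bundle_data C 2) (c1 c2 : int) : Prop :=
  exists n0 : nat, forall n : nat, (n0 <= n)%N ->
  exists2 N : nat, h0_eq E n%:Z N &
    let a : int := c1 + 2 * n%:Z in
    let b : int := c2 + c1 * n%:Z + n%:Z ^+ 2 in
    6 * N%:Z = a ^+ 3 - 3 * a * b + 6 * a ^+ 2 - 12 * b + 11 * a + 12.

Record instanton (C : fieldType) (k : nat) (E : bundle_data C 2) : Prop := {
  instanton_bundle : is_bundle E;
  instanton_c1 : c1_eq E 0;
  instanton_c2 : c2_eq E 0 k%:Z;
  instanton_h0 : h0_eq E 0 0;
  instanton_h1 : h1_eq0 E (- 2) }.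

(* dim W = 2k+2, written k.+1 * 2 to match S^k U (x) U'.  A_i is the matrix
   whose rows are in W, on which the form is (w, w') |-> w *m J *m w'^T. *)
Definition monad_map (C : fieldType) (k : nat)
    (A : 'I_4 -> 'M[C]_(k, k.+1 * 2)) (x : 'rV[C]_4) : 'M[C]_(k, k.+1 * 2) :=
  \sum_(i < 4) x 0 i *: A i.

Record monad (C : fieldType) (k : nat) (J : 'M[C]_(k.+1 * 2))
    (A : 'I_4 -> 'M[C]_(k, k.+1 * 2)) : Prop := {
  monad_skew : J^T = - J;
  monad_nondeg : J \in unitmx;
  monad_surj : forall x : 'rV[C]_4, x != 0 -> \rank (monad_map A x) = k;
  monad_complex : forall x : 'rV[C]_4,
    monad_map A x *m J *m (monad_map A x)^T = 0 }.

(* E is isomorphic to ker A / im A^t: there is a surjective bundle map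
   Phi : ker A -> E with kernel im A^t = im (J A^T).  As ker A is a direct
   summand of W (x) O over an affine open set, Phi is given there by a matrix
   acting on W (x) O, of which only the restriction to ker A matters. *)
Definition represents (C : fieldType) (k : nat) (J : 'M[C]_(k.+1 * 2))
    (A : 'I_4 -> 'M[C]_(k, k.+1 * 2)) (E : bundle_data C 2) : Prop :=
  monad J A /\
  exists Phi : 'I_(nchart E) -> 'rV[C]_4 -> 'M[C]_(2, k.+1 * 2),
    [/\ forall i, regular_mx (dom i) 0 (Phi i),
        forall i j x (w : 'cV[C]_(k.+1 * 2)), dom i x -> dom j x ->
          monad_map A x *m w = 0 -> Phi i x *m w = trans i j x *m (Phi j x *m w),
        forall i x (v : 'cV[C]_2), dom i x ->
          exists2 w : 'cV[C]_(k.+1 * 2), monad_map A x *m w = 0 & Phi i x *m w = v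
      & forall i x (w : 'cV[C]_(k.+1 * 2)), dom i x -> monad_map A x *m w = 0 ->
          (Phi i x *m w = 0 <->
           exists u : 'cV[C]_k, w = J *m (monad_map A x)^T *m u)].

(* The variables 'X_0, ..., 'X_5 of {mpoly C[6]} are the Pluecker coordinates
   p01, p02, p03, p12, p13, p23. *)
Definition plucker_pair : 6.-tuple ('I_4 * 'I_4) :=
  [tuple (0, 1); (0, 2); (0, 3); (1, 2); (1, 3); (2, 3)].

Definition plucker_quadric (C : fieldType) : {mpoly C[6]} :=
  'X_0 * 'X_5 - 'X_1 * 'X_4 + 'X_2 * 'X_3.

(* The (a, b) entry of the matrix equation sum_(i < j) p_ij A_i J A_j^t = 0 *)
Definition jump_form (C : fieldType) (k : nat) (J : 'M[C]_(k.+1 * 2))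
    (A : 'I_4 -> 'M[C]_(k, k.+1 * 2)) (a b : 'I_k) : {mpoly C[6]} :=
  \sum_(m < 6)
    (A (tnth plucker_pair m).1 *m J *m (A (tnth plucker_pair m).2)^T) a b *: 'X_m.

Definition Zk_ideal (C : fieldType) (k : nat) (J : 'M[C]_(k.+1 * 2))
    (A : 'I_4 -> 'M[C]_(k, k.+1 * 2)) (p : {mpoly C[6]}) : Prop :=
  exists (q : {mpoly C[6]}) (h : 'I_k -> 'I_k -> {mpoly C[6]}),
    p = q * plucker_quadric C
        + \sum_(a < k) \sum_(b < k) h a b * jump_form J A a b.

(* The closed subscheme of P^(n-1) with homogeneous ideal I has length at least
   m.  The length of a finite projective scheme is the constant value of its
   Hilbert polynomial, i.e. dim (S/I)_d for d >> 0; for a scheme of positive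
   dimension, dim (S/I)_d tends to infinity, in accordance with the convention
   that its length is infinite. *)
Definition length_ge (C : fieldType) (n : nat) (I : {mpoly C[n]} -> Prop)
    (m : nat) : Prop :=
  exists d0 : nat, forall d : nat, (d0 <= d)%N ->
  exists f : 'I_m -> {mpoly C[n]},
    (forall l, f l \is d.-homog) /\
    (forall c : 'I_m -> C, I (\sum_(l < m) c l *: f l) -> forall l, c l = 0).

(* The monad representing E is unique up to GL(I) x Sp(W), which leaves the
   ideal unchanged. *)
Definition length_Zk_ge (C : fieldType) (k : nat) (E : bundle_data C 2)
    (m : nat) : Prop :=
  exists (J : 'M[C]_(k.+1 * 2)) (A : 'I_4 -> 'M[C]_(k, k.+1 * 2)),
    represents J A E /\ length_ge (Zk_ideal J A) m.

Definition meval_mx (C : fieldType) (m n : nat) (p : {mpoly C[m * n]})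
    (M : 'M[C]_(m, n)) : C := p.@[mxvec M 0].

Definition zclosed (C : fieldType) (m n : nat) (Z : 'M[C]_(m, n) -> Prop) :
    Prop :=
  exists S : {mpoly C[m * n]} -> Prop,
    forall M, Z M <-> (forall p, S p -> meval_mx p M = 0).

Definition zconnected (C : fieldType) (m n : nat) (X : 'M[C]_(m, n) -> Prop) :
    Prop :=
  forall Z1 Z2 : 'M[C]_(m, n) -> Prop, zclosed Z1 -> zclosed Z2 ->
    (forall M, X M -> Z1 M \/ Z2 M) ->
    (exists2 M, X M & Z1 M) -> (exists2 M, X M & Z2 M) ->
    exists2 M, X M & Z1 M /\ Z2 M.

Definition zirreducible (C : fieldType) (m n : nat) (X : 'M[C]_(m, n) -> Prop) :
    Prop :=
  (exists M, X M) /\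
  forall Z1 Z2 : 'M[C]_(m, n) -> Prop, zclosed Z1 -> zclosed Z2 ->
    (forall M, X M -> Z1 M \/ Z2 M) ->
    (forall M, X M -> Z1 M) \/ (forall M, X M -> Z2 M).

(* For X closed in the space of matrices, e.g. a closed subgroup of SL_n: the
   Krull dimension of X is at least 1. *)
Definition positive_dim (C : fieldType) (m n : nat) (X : 'M[C]_(m, n) -> Prop) :
    Prop :=
  exists Z0 Z1 : 'M[C]_(m, n) -> Prop,
    [/\ zclosed Z0 /\ zirreducible Z0, zclosed Z1 /\ zirreducible Z1,
        forall M, Z0 M -> Z1 M, exists2 M, Z1 M & ~ Z0 M
      & forall M, Z1 M -> X M].

Record closed_subgroup (C : fieldType) (n : nat) (G : 'M[C]_n -> Prop) : Prop := {
  subgroup_GL : forall g, G g -> g \in unitmx;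
  subgroup_1 : G 1%:M;
  subgroup_mul : forall g h, G g -> G h -> G (g *m h);
  subgroup_inv : forall g, G g -> G (invmx g);
  (* closed in GL_n *)
  subgroup_closed : exists2 Z : 'M[C]_n -> Prop, zclosed Z &
    forall g, G g <-> g \in unitmx /\ Z g }.

Definition Sym (C : fieldType) (E : bundle_data C 2) (g : 'M[C]_4) : Prop :=
  \det g = 1 /\ bundle_iso (pull g E) E.

(* Connected component of the identity *)
Definition Sym0 (C : fieldType) (E : bundle_data C 2) (g : 'M[C]_4) : Prop :=
  exists X : 'M[C]_4 -> Prop,
    [/\ zconnected X, forall h, X h -> Sym E h, X 1%:M & X g].

(* Matrix of S^(m-1)(a) in the basis e_0^(m-1-j) e_1^j (0 <= j < m), for a 2 x 2
   matrix a acting on U = <e_0, e_1>; monomials are dehomogenized by e_0 = 1,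
   e_1 = 'X. *)
Definition sympow (C : fieldType) (m : nat) (a : 'M[C]_2) : 'M[C]_m :=
  \matrix_(i < m, j < m)
    (((a 0 0)%:P + a 1 0 *: 'X) ^+ (m.-1 - j)
     * ((a 0 1)%:P + a 1 1 *: 'X) ^+ j)`_i.

(* U = U' = C^2; tau, beta and gamma are the isomorphisms U (x) U' -> V,
   S^k U (x) U' -> W and S^(k-1) U -> I, and g |-> (rho g, rho' g) is the
   inclusion of G in GL(U) x GL(U').  The lifted action of g on W (x) I (x) V
   sends sum_j A_j (x) x_j to sum_j (gI A_j gW^T) (x) g x_j. *)
Definition fine_action (C : fieldType) (k : nat) (E : bundle_data C 2)
    (G : 'M[C]_4 -> Prop) : Prop :=
  exists (tau : 'M[C]_(2 * 2)) (beta : 'M[C]_(k.+1 * 2)) (gamma : 'M[C]_k)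
         (rho rho' : 'M[C]_4 -> 'M[C]_2),
  [/\ [/\ tau \in unitmx, beta \in unitmx & gamma \in unitmx],
      (forall i j, exists p p' : {mpoly C[4 * 4]}, forall g, G g ->
         rho g i j = meval_mx p g /\ rho' g i j = meval_mx p' g),
      (forall g, G g -> rho g \in unitmx /\ rho' g \in unitmx),
      (forall g h, G g -> G h ->
         rho (g *m h) = rho g *m rho h /\ rho' (g *m h) = rho' g *m rho' h)
    & (forall g, G g -> g = tau *m (rho g *t rho' g) *m invmx tau) /\
      exists (J : 'M[C]_(k.+1 * 2)) (A : 'I_4 -> 'M[C]_(k, k.+1 * 2)),
        represents J A E /\
        forall g, G g ->
          let gW := beta *m (sympow k.+1 (rho g) *t rho' g) *m invmx beta in
          let gI := gamma *m sympow k (rho g) *m invmx gamma in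
          gW^T *m J *m gW = J /\
          forall i : 'I_4, \sum_(j < 4) g i j *: (gI *m A j *m gW^T) = A i].

(* Main.v *)
Require Import Defs.
From mathcomp Require Import all_boot all_order all_algebra.
From mathcomp Require Import zify ring.
From mathcomp Require boolp.

(* On a line of order k the rows of A span a Lagrangian subspace of W.  Since
   the equations of Z_k are linear in the Pluecker coordinates, length at least
   2 means that they vanish on a pencil of bivectors.  Up to a change of basis
   of the pencil there are three cases.
   - It contains two skew lines.  Since h^0(E) = 0, the rows of A span W, so W
     is the sum of the two Lagrangians, and the torus acting with weights t, 1/t
     on the two lines lifts to Sp(W) and fixes A.
   - It consists of a line and a tangent vector x /\ y' + x' /\ y of rank 2.
     With R, R' the rows of A at (x, y) and (x', y'), the matrix R J R'^T is
     symmetric, so R' |-> R, R |-> 0 is well defined; this nilpotent element of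
     sp(W) exponentiates to a unipotent group fixing A.
   - All its bivectors are decomposable, so two lines of order k meet.  For
     k = 1 the equations are few enough to choose another pencil; for k >= 2
     one gets an m x (m + 1) matrix of linear forms of constant rank m on a
     plane, which does not exist by a degree argument.
   In the first two cases the group acts through U' only, with trivial rho.  A
   symmetry of A over g yields an isomorphism g^* E = E because ker A / im A^t
   maps regularly to E. *)

Set Implicit Arguments.
Unset Strict Implicit.
Unset Printing Implicit Defensive.

Import Order.TTheory GRing.Theory Num.Theory.
Local Open Scope ring_scope.

(** * Regular functions of degree 0 *)

(** The symmetric powers matter only through their dimensions: a Lagrangian subspace of W has
    dimension k + 1 = dim S^k U. With trivial [rho], the isomorphism S^k U (x) U' = W is therefore a
    basis of W made of two families of k + 1 vectors, and U (x) U' = V is a pair of skew lines; in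
    the tangent case the second line is an auxiliary one. The cases are separated on the space K of
    bivectors killed by the linear equations. A point of K off the Pluecker quadric, joined to
    another point of K, gives a line that cuts the quadric twice or touches it. Without such a point
    K is totally isotropic. For k = 1 this is impossible: one equation leaves dim K >= 5, while
    isotropic subspaces of C^6 have dimension at most 3. On the side of bundles the obstacle is
    regularity. To act on E one lifts vectors to ker A, and pointwise lifts have no reason to vary
    regularly; but the induced map does not depend on the lift, so near each point it can be
    computed with a regular one. *)

Lemma comp_mpoly_dhomog (C : fieldType) (n m d : nat) (p : {mpoly C[n]})
    (lq : n.-tuple {mpoly C[m]}) :
  p \is d.-homog -> (forall i, tnth lq i \is 1.-homog) -> p \mPo lq \is d.-homog.
Proof.
move=> hp hq; rewrite comp_mpolyEX big_seq; apply: rpred_sum => mm hmm.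
apply: dhomogZ; rewrite comp_mpolyX.
have <- : mdeg mm = d by apply: (dhomog_mf hp).
rewrite mdegE.
apply: (big_ind2 (fun p e => p \is e.-homog)).
- exact: dhomog1.
- by move=> ????; apply: dhomogM.
by move=> i _; rewrite -[X in X.-homog]mul1n; apply/dhomogMn/hq.
Qed.

(** The same tuple as in [pull], so that the charts of [pull g E] are of the form
    [p \mPo lin_subst g] by conversion. *)
Definition lin_subst (C : fieldType) (n : nat) (g : 'M[C]_n) :
    n.-tuple {mpoly C[n]} := [tuple \sum_(l < n) g l m *: 'X_l | m < n].

Lemma dhomogXU (C : fieldType) (n : nat) (i : 'I_n) :
  ('X_i : {mpoly C[n]}) \is 1.-homog.
Proof. by rewrite dhomogX; apply/eqP; exact: mdeg1. Qed.

Lemma dhomog_lin_subst (C : fieldType) (n d : nat) (g : 'M[C]_n)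
    (p : {mpoly C[n]}) : p \is d.-homog -> p \mPo lin_subst g \is d.-homog.
Proof.
move=> hp; apply: comp_mpoly_dhomog => // i; rewrite tnth_mktuple.
by apply: rpred_sum => l _; apply/dhomogZ/dhomogXU.
Qed.

Lemma meval_lin_subst (C : fieldType) (n : nat) (g : 'M[C]_n)
    (p : {mpoly C[n]}) (x : 'rV[C]_n) :
  (p \mPo lin_subst g).@[x 0] = p.@[(x *m g) 0].
Proof.
rewrite comp_mpoly_meval; apply: meval_eq => m; rewrite tnth_mktuple mxE.
rewrite raddf_sum; apply: eq_bigr => l _ /=.
by rewrite mevalZ mevalXU mulrC.
Qed.

Lemma dhomog_meval_scale (C : fieldType) (n d : nat) (p : {mpoly C[n]})
    (c : C) (v : 'I_n -> C) :
  p \is d.-homog -> p.@[fun i => c * v i] = c ^+ d * p.@[v].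
Proof.
move=> hp; rewrite !mevalE mulr_sumr !big_seq; apply: eq_bigr => m hm.
rewrite mulrCA; congr (_ * _).
under eq_bigr do rewrite exprMn.
rewrite big_split /=; congr (_ * _).
have <- : mdeg m = d by apply: (dhomog_mf hp hm).
by rewrite mdegE expr_sum.
Qed.

Lemma dhomog_meval0 (C : fieldType) (n d : nat) (p : {mpoly C[n]}) :
  (0 < d)%N -> p \is d.-homog -> p.@[(0 : 'rV[C]_n) 0] = 0.
Proof.
move=> d0 hp.
have -> : p.@[(0 : 'rV[C]_n) 0] = p.@[fun i => 0 * (0 : C)].
  by apply: meval_eq => i; rewrite mxE mul0r.
by rewrite (dhomog_meval_scale _ _ hp) expr0n gtn_eqF ?mul0r.
Qed.

(** Regularity of degree 0 near one point. The neighbourhood is the nonvanishing locus of a single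
    denominator, so closure properties reduce to arithmetic of fractions. *)
Definition regular_at (C : fieldType) (D : 'rV[C]_4 -> Prop)
    (h : 'rV[C]_4 -> C) (x0 : 'rV[C]_4) : Prop :=
  exists (d : nat) (P Q : {mpoly C[4]}),
    [/\ P \is d.-homog, Q \is d.-homog, Q.@[x0 0] != 0
      & forall x, D x -> Q.@[x 0] != 0 -> h x = P.@[x 0] / Q.@[x 0]].

Lemma regular_funP (C : fieldType) (D : 'rV[C]_4 -> Prop) h :
  regular_fun D 0 h <-> (forall x0, D x0 -> regular_at D h x0).
Proof.
split=> H x0 /H.
  by case=> d [e [P [Q [/eqP]]]]; rewrite addr0 => /eqP[<-] *; exists d, P, Q.
by case=> d [P [Q [*]]]; exists d, d, P, Q; split=> //; rewrite addr0.
Qed.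

Section RegularAt.
Variables (C : fieldType) (x0 : 'rV[C]_4).
Implicit Types (D : 'rV[C]_4 -> Prop) (f h : 'rV[C]_4 -> C).

Lemma regular_at_sub D D' h :
  (forall x, D' x -> D x) -> regular_at D h x0 -> regular_at D' h x0.
Proof.
move=> sDD' [d [P [Q [hP hQ Q0 hh]]]]; exists d, P, Q; split=> // x /sDD'.
exact: hh.
Qed.

Lemma regular_at_const D (c : C) : regular_at D (fun=> c) x0.
Proof.
exists 0%N, c%:MP, 1; split; rewrite ?meval1 ?oner_neq0 ?dhomog1 //.
  by rewrite -[c%:MP]mulr1 mul_mpolyC; apply/dhomogZ/dhomog1.
by move=> x _ _; rewrite meval1 mevalC divr1.
Qed.

Lemma regular_atD D f h :
  regular_at D f x0 -> regular_at D h x0 -> regular_at D (fun x => f x + h x) x0.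
Proof.
move=> [d [P [Q [hP hQ Q0 hf]]]] [e [P' [Q' [hP' hQ' Q'0 hh]]]].
exists (d + e)%N, (P * Q' + P' * Q), (Q * Q'); split.
- by apply: rpredD; [|rewrite addnC]; apply: dhomogM.
- exact: dhomogM.
- by rewrite mevalM mulf_neq0.
move=> x Dx; rewrite mevalM mulf_eq0 negb_or => /andP[q q'].
by rewrite hf // hh // mevalD !mevalM addf_div.
Qed.

Lemma regular_atM D f h :
  regular_at D f x0 -> regular_at D h x0 -> regular_at D (fun x => f x * h x) x0.
Proof.
move=> [d [P [Q [hP hQ Q0 hf]]]] [e [P' [Q' [hP' hQ' Q'0 hh]]]].
exists (d + e)%N, (P * P'), (Q * Q'); split; try exact: dhomogM.
  by rewrite mevalM mulf_neq0.
move=> x Dx; rewrite mevalM mulf_eq0 negb_or => /andP[q q'].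
by rewrite hf // hh // !mevalM mulf_div.
Qed.

Lemma regular_atV D h :
  D x0 -> h x0 != 0 -> regular_at D h x0 -> regular_at D (fun x => (h x)^-1) x0.
Proof.
move=> Dx0 h0 [d [P [Q [hP hQ Q0 hh]]]].
have P0 : P.@[x0 0] != 0.
  by apply: contraNneq h0 => P0; rewrite hh // P0 mul0r.
(* The common factor [Q] keeps [x] in the locus where [h = P / Q] is known. *)
exists (d + d)%N, (Q * Q), (P * Q); split; try exact: dhomogM.
  by rewrite mevalM mulf_neq0.
move=> x Dx; rewrite mevalM mulf_eq0 negb_or => /andP[p q].
by rewrite hh // !mevalM invf_div -mulf_div divff // mulr1.
Qed.

Lemma regular_at_sum D (I : Type) (r : seq I) (F : I -> 'rV[C]_4 -> C) :
  (forall i, regular_at D (F i) x0) ->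
  regular_at D (fun x => \sum_(i <- r) F i x) x0.
Proof.
move=> hF; elim: r => [|i r IH].
  have [d [P [Q [hP hQ Q0 hh]]]] := regular_at_const D 0.
  by exists d, P, Q; split=> // x Dx q; rewrite big_nil; apply: hh.
have [d [P [Q [hP hQ Q0 hh]]]] := regular_atD (hF i) IH.
by exists d, P, Q; split=> // x Dx q; rewrite big_cons; apply: hh.
Qed.

Lemma regular_at_prod D (I : Type) (r : seq I) (F : I -> 'rV[C]_4 -> C) :
  (forall i, regular_at D (F i) x0) ->
  regular_at D (fun x => \prod_(i <- r) F i x) x0.
Proof.
move=> hF; elim: r => [|i r IH].
  have [d [P [Q [hP hQ Q0 hh]]]] := regular_at_const D 1.
  by exists d, P, Q; split=> // x Dx q; rewrite big_nil; apply: hh.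
have [d [P [Q [hP hQ Q0 hh]]]] := regular_atM (hF i) IH.
by exists d, P, Q; split=> // x Dx q; rewrite big_cons; apply: hh.
Qed.

Lemma eq_regular_at D f h :
  (forall x, D x -> f x = h x) -> regular_at D f x0 -> regular_at D h x0.
Proof.
move=> efh [d [P [Q [hP hQ Q0 hh]]]].
by exists d, P, Q; split=> // x Dx q; rewrite -efh // hh.
Qed.

(** An open condition given by a regular function [u] can be absorbed into the denominator:
    numerator and denominator are both multiplied by [P * Q], where [u = P / Q]. *)
Lemma regular_at_near D (u f h : 'rV[C]_4 -> C) :
  D x0 -> regular_at D u x0 -> u x0 != 0 ->
  (forall x, D x -> u x != 0 -> f x = h x) ->
  regular_at D f x0 -> regular_at D h x0.
Proof.
move=> Dx0 [d [P [Q [hP hQ Q0 hu]]]] u0 efh [e [P' [Q' [hP' hQ' Q'0 hf]]]].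
have P0 : P.@[x0 0] != 0.
  by apply: contraNneq u0 => P0; rewrite hu // P0 mul0r.
exists (d + d + e)%N, (P * Q * P'), (P * Q * Q').
split; try by apply: dhomogM => //; apply: dhomogM.
  by rewrite !mevalM !mulf_neq0.
move=> x Dx; rewrite !mevalM !mulf_eq0 !negb_or => /andP[/andP[p q] q'].
rewrite -efh //; last by rewrite hu // mulf_neq0 ?invr_neq0.
by rewrite hf // -mulf_div divff ?mul1r // mulf_neq0.
Qed.

Definition regular_mx_at D (p q : nat) (M : 'rV[C]_4 -> 'M[C]_(p, q)) : Prop :=
  forall i j, regular_at D (fun x => M x i j) x0.

Lemma regular_mx_at_const D p q (M : 'M[C]_(p, q)) :
  regular_mx_at D (fun=> M).
Proof. by move=> i j; apply: regular_at_const. Qed.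

Lemma regular_mx_atM D p q r (M : 'rV[C]_4 -> 'M[C]_(p, q))
    (N : 'rV[C]_4 -> 'M[C]_(q, r)) :
  regular_mx_at D M -> regular_mx_at D N ->
  regular_mx_at D (fun x => M x *m N x).
Proof.
move=> hM hN i j.
apply: (eq_regular_at (f := fun x => \sum_l M x i l * N x l j)).
  by move=> x _; rewrite mxE.
by apply: regular_at_sum => l; apply: regular_atM.
Qed.

Lemma regular_mx_atB D p q (M N : 'rV[C]_4 -> 'M[C]_(p, q)) :
  regular_mx_at D M -> regular_mx_at D N ->
  regular_mx_at D (fun x => M x - N x).
Proof.
move=> hM hN i j.
apply: (eq_regular_at (f := fun x => M x i j + (-1) * N x i j)).
  by move=> x _; rewrite !mxE mulN1r.
apply: regular_atD => //; apply: regular_atM => //; exact: regular_at_const.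
Qed.

Lemma regular_at_det D p (M : 'rV[C]_4 -> 'M[C]_p) :
  regular_mx_at D M -> regular_at D (fun x => \det (M x)) x0.
Proof.
move=> hM; apply: regular_at_sum => s; apply: regular_atM.
  exact: regular_at_const.
by apply: regular_at_prod => i; apply: hM.
Qed.

Lemma regular_mx_at_inv D p (M : 'rV[C]_4 -> 'M[C]_p) :
  D x0 -> regular_mx_at D M -> M x0 \in unitmx ->
  regular_mx_at D (fun x => invmx (M x)).
Proof.
move=> Dx0 hM uM i j.
have hd := regular_at_det hM; have d0 : \det (M x0) != 0.
  by rewrite -unitfE -unitmxE.
(* [invmx] returns its argument on singular matrices, so Cramer's formula holds only where the
   determinant is nonzero. *)
apply: (regular_at_near (u := fun x => \det (M x))
  (f := fun x => (\det (M x))^-1 * \adj (M x) i j)) => //.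
  by move=> x _; rewrite /invmx unitmxE unitfE => ->; rewrite [RHS]mxE.
apply: regular_atM; first exact: regular_atV.
apply: (eq_regular_at (f := fun x => cofactor (M x) j i)).
  by move=> x _; rewrite mxE.
apply: regular_atM; first exact: regular_at_const.
apply: regular_at_det => a b.
apply: (eq_regular_at (f := fun x => M x (lift j a) (lift i b))) => //.
by move=> x _; rewrite !mxE.
Qed.

Lemma regular_at_coord_div D (i l : 'I_4) :
  x0 0 l != 0 -> regular_at D (fun x => x 0 i / x 0 l) x0.
Proof.
move=> h; exists 1%N, 'X_i, 'X_l; split; rewrite ?dhomogXU ?mevalXU //.
by move=> x _ _; rewrite !mevalXU.
Qed.

End RegularAt.

Lemma regular_at_lin (C : fieldType) D (h : 'rV[C]_4 -> C) (g : 'M[C]_4) x0 :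
  regular_at D h (x0 *m g) ->
  regular_at (fun x => D (x *m g)) (fun x => h (x *m g)) x0.
Proof.
move=> [d [P [Q [hP hQ Q0 hh]]]].
exists d, (P \mPo lin_subst g), (Q \mPo lin_subst g).
split; rewrite ?dhomog_lin_subst ?meval_lin_subst //.
by move=> x Dx; rewrite !meval_lin_subst => /hh ->.
Qed.

Lemma regular_mxP (C : fieldType) (D : 'rV[C]_4 -> Prop) p q
    (M : 'rV[C]_4 -> 'M[C]_(p, q)) :
  regular_mx D 0 M <-> (forall x0, D x0 -> regular_mx_at x0 D M).
Proof.
split=> H.
  by move=> x0 Dx0 i j; have /regular_funP := H i j; apply.
by move=> i j; apply/regular_funP => x0 Dx0; apply: H.
Qed.

(** * Bundle isomorphisms induced by symmetries of the monad *)

Lemma row_freeP0 (C : fieldType) (m n : nat) (M : 'M[C]_(m, n)) :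
  (forall v : 'rV_m, v *m M = 0 -> v = 0) -> row_free M.
Proof.
move=> H; rewrite -kermx_eq0; apply/rowV0P => v /sub_kermxP; exact: H.
Qed.

(** A right inverse of [P] with values in the kernel of [M]: the columns of [(kermx M^T)^T] span
    that kernel. The choice is made matrix by matrix, with no regularity in [M] and [P]. *)
Definition lift_mx (C : fieldType) (k n r : nat) (M : 'M[C]_(k, n))
    (P : 'M[C]_(r, n)) : 'M[C]_(n, r) :=
  (kermx M^T)^T *m pinvmx (P *m (kermx M^T)^T).

Lemma lift_mxP (C : fieldType) (k n r : nat) (M : 'M[C]_(k, n))
    (P : 'M[C]_(r, n)) :
  (forall v : 'cV_r, exists2 w : 'cV_n, M *m w = 0 & P *m w = v) ->
  M *m lift_mx M P = 0 /\ P *m lift_mx M P = 1%:M.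
Proof.
move=> H; rewrite /lift_mx; set K := (kermx M^T)^T; split.
  rewrite mulmxA [M *m K](_ : _ = 0) ?mul0mx //; apply: trmx_inj.
  by rewrite trmx_mul trmxK mulmx_ker trmx0.
rewrite mulmxA mulmxVp //; apply: row_freeP0 => u hu.
apply/rowP => j.
suff H' v : u *m v = 0 :> 'M_1.
  by have := H' (delta_mx j 0); rewrite -colE => /matrixP/(_ 0 0); rewrite !mxE.
have [w Mw <-] := H v.
have : (w^T <= kermx M^T)%MS by apply/sub_kermxP; rewrite -trmx_mul Mw trmx0.
case/submxP => D /(congr1 trmx); rewrite trmxK trmx_mul -/K => ->.
by rewrite !mulmxA -(mulmxA u) hu mul0mx.
Qed.

Lemma mulmx_cV_inj (C : fieldType) (m n : nat) (M N : 'M[C]_(m, n)) :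
  (forall v : 'cV_n, M *m v = N *m v) -> M = N.
Proof.
move=> H; apply/matrixP => i j; have /matrixP/(_ i 0) := H (delta_mx j 0).
by rewrite -!colE !mxE.
Qed.

Lemma monad_map_regular (C : fieldType) (k : nat)
    (A : 'I_4 -> 'M[C]_(k, k.+1 * 2)) (D : 'rV[C]_4 -> Prop) (x0 : 'rV[C]_4) l :
  x0 0 l != 0 ->
  regular_mx_at x0 D (fun x => (x 0 l)^-1 *: monad_map A x).
Proof.
move=> hl i j.
apply: (eq_regular_at (f := fun x => \sum_m (x 0 m / x 0 l) * A m i j)).
  move=> x _; rewrite mxE summxE mulr_sumr; apply: eq_bigr => m _.
  by rewrite mxE mulrCA mulrA.
apply: regular_at_sum => m; apply: regular_atM; last exact: regular_at_const.
exact: regular_at_coord_div.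
Qed.

Lemma dom_neq0 (C : fieldType) (r : nat) (E : bundle_data C r) i x :
  is_bundle E -> dom (E := E) i x -> x != 0.
Proof.
move=> hE; have [d d0 hd] := chart_homog hE i; rewrite /dom.
by apply: contraNneq => ->; rewrite (dhomog_meval0 d0 hd).
Qed.

Section BundleIso.
Variables (C : fieldType) (k : nat) (E : bundle_data C 2).
Variables (J : 'M[C]_(k.+1 * 2)) (A : 'I_4 -> 'M[C]_(k, k.+1 * 2)).
Variable Phi : 'I_(nchart E) -> 'rV[C]_4 -> 'M[C]_(2, k.+1 * 2).
Hypothesis bundleE : is_bundle E.
Hypothesis monadA : monad J A.
Hypothesis Phi_reg : forall i, regular_mx (dom i) 0 (Phi i).
Hypothesis Phi_trans : forall i j x (w : 'cV[C]_(k.+1 * 2)),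
  dom i x -> dom j x -> monad_map A x *m w = 0 ->
  Phi i x *m w = trans i j x *m (Phi j x *m w).
Hypothesis Phi_surj : forall i x (v : 'cV[C]_2), dom i x ->
  exists2 w : 'cV[C]_(k.+1 * 2), monad_map A x *m w = 0 & Phi i x *m w = v.
Hypothesis Phi_ker : forall i x (w : 'cV[C]_(k.+1 * 2)),
  dom i x -> monad_map A x *m w = 0 ->
  (Phi i x *m w = 0 <->
   exists u : 'cV[C]_k, w = J *m (monad_map A x)^T *m u).

Variables (g : 'M[C]_4) (Gam : 'M[C]_(k.+1 * 2)).
Hypothesis symp : Gam *m J *m Gam^T = J.
Hypothesis equiv : forall x, monad_map A x = monad_map A (x *m g) *m Gam.

Let lift i y := lift_mx (monad_map A y) (Phi i y).

Let liftP i y : dom i y ->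
  monad_map A y *m lift i y = 0 /\ Phi i y *m lift i y = 1%:M.
Proof. by move=> dy; apply: lift_mxP => v; apply: Phi_surj. Qed.

Let unitGam : Gam \in unitmx.
Proof.
have := monad_nondeg monadA; rewrite -{1}symp -mulmxA unitmx_mul.
by case/andP.
Qed.

(** The map from the fibre of E at [x *m g] to the fibre at [x] induced by [invmx Gam], which sends
    ker A to ker A between these points by [equiv]. *)
Definition sym_map j i x : 'M[C]_2 := Phi j x *m invmx Gam *m lift i (x *m g).

Let ker_Gam x (w : 'cV_(k.+1 * 2)) :
  monad_map A (x *m g) *m w = 0 -> monad_map A x *m (invmx Gam *m w) = 0.
Proof. by move=> h; rewrite equiv mulmxA mulmxK. Qed.

(** Independence of the lift: two lifts of a vector differ by an element of im A^t at [x *m g].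
    Since [Gam] is symplectic, [invmx Gam] carries it to im A^t at [x], where [Phi] vanishes. *)
Lemma sym_mapE j i x (w : 'cV_(k.+1 * 2)) :
  dom j x -> dom i (x *m g) -> monad_map A (x *m g) *m w = 0 ->
  sym_map j i x *m (Phi i (x *m g) *m w) = Phi j x *m (invmx Gam *m w).
Proof.
move=> dj di hw; have [Al Pl] := liftP di.
set y := x *m g in di hw Al Pl *; set v := Phi i y *m w.
have hker : monad_map A y *m (lift i y *m v - w) = 0.
  by rewrite mulmxBr hw mulmxA Al mul0mx subr0.
have [] := Phi_ker di hker; rewrite mulmxBr mulmxA Pl mul1mx subrr.
move=> /(_ erefl) [u hu] _; rewrite /sym_map -/y -(mulmxA _ (lift i y)) -(mulmxA (Phi j x)).
apply/eqP; rewrite -subr_eq0 -!mulmxBr hu.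
apply/eqP/(Phi_ker dj); first by rewrite ker_Gam // -hu.
exists u; rewrite [monad_map A x]equiv -/y trmx_mul.
by rewrite -[in LHS]symp -!mulmxA mulKmx.
Qed.

Lemma sym_map_unit j i x :
  dom j x -> dom i (x *m g) -> sym_map j i x \in unitmx.
Proof.
move=> dj di; rewrite -unitmx_tr -row_free_unit; apply: row_freeP0 => v.
move=> /(congr1 trmx); rewrite trmx_mul trmxK trmx0 => hv.
have [w hw wv] := Phi_surj v^T di.
apply: trmx_inj; rewrite trmx0 -wv; apply/(Phi_ker di hw).
move: hv; rewrite -wv sym_mapE // => /(Phi_ker dj (ker_Gam hw)) [u hu].
exists u; rewrite -[w](mulKVmx unitGam) hu [monad_map A x]equiv trmx_mul.
by rewrite !mulmxA symp.
Qed.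

Lemma sym_map_trans j j' i i' x :
  dom j x -> dom j' x -> dom i (x *m g) -> dom i' (x *m g) ->
  trans j' j x *m sym_map j i x = sym_map j' i' x *m trans i' i (x *m g).
Proof.
move=> dj dj' di di'; apply: mulmx_cV_inj => v.
have [w hw <-] := Phi_surj v di.
rewrite -(mulmxA (trans _ _ _)) -(mulmxA (sym_map _ _ _)) -Phi_trans //.
by rewrite !sym_mapE // -Phi_trans // ker_Gam.
Qed.

(** By [sym_mapE] the pointwise [lift] may be replaced near [y0] by any family [L] in ker A that is
    regular, once it is normalized by the inverse of [Phi i y *m L y]. *)
Lemma sym_map_regular j i :
  regular_mx (fun x => dom j x /\ dom i (x *m g)) 0 (sym_map j i).
Proof.
apply/regular_mxP => x0 [dj0 di0].
set D := fun x : 'rV[C]_4 => _; set y0 := x0 *m g.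
have y0n : y0 != 0 := dom_neq0 bundleE di0.
have /rV0Pn[l hl] := y0n.
have [al pl] := liftP di0; rewrite -/y0 in al pl.
pose Ah (y : 'rV[C]_4) := (y 0 l)^-1 *: monad_map A y.
have : row_free (Ah y0).
  rewrite /row_free mxrank_scale_nz ?invr_eq0 //.
  by rewrite (monad_surj monadA y0n).
case/row_freeP => G hG.
(* The constant lift at [y0] is projected to ker A(y) along the columns of [G], a right inverse of
   the rescaled A at [y0]. *)
pose L y := lift i y0 - G *m invmx (Ah y *m G) *m (Ah y *m lift i y0).
have L0 : L y0 = lift i y0 by rewrite /L /Ah -!scalemxAl al scaler0 mulmx0 subr0.
have AL (y : 'rV[C]_4) : y 0 l != 0 -> Ah y *m G \in unitmx -> monad_map A y *m L y = 0.
  move=> yl u; have : Ah y *m L y = 0.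
    by rewrite mulmxBr !mulmxA mulmxV // mul1mx subrr.
  move/eqP; rewrite -scalemxAl scaler_eq0 invr_eq0 (negPf yl) /=.
  by move/eqP.
pose Dy y := dom (E := E) i y.
have rA : regular_mx_at y0 Dy Ah by apply: monad_map_regular.
have rG : regular_mx_at y0 Dy (fun y => Ah y *m G).
  by apply: regular_mx_atM => //; apply: regular_mx_at_const.
have rL : regular_mx_at y0 Dy L.
  apply: regular_mx_atB; first exact: regular_mx_at_const.
  apply: regular_mx_atM; last first.
    by apply: regular_mx_atM => //; apply: regular_mx_at_const.
  apply: regular_mx_atM; first exact: regular_mx_at_const.
  by apply: regular_mx_at_inv => //; rewrite hG unitmx1.
have rP : regular_mx_at y0 Dy (Phi i).
  by have /regular_mxP := Phi_reg (i := i); apply.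
have rPL : regular_mx_at y0 Dy (fun y => Phi i y *m L y).
  exact: regular_mx_atM.
have rV : regular_mx_at y0 Dy (fun y => invmx (Phi i y *m L y)).
  by apply: regular_mx_at_inv => //; rewrite L0 pl unitmx1.
have rR : regular_mx_at x0 D (fun x =>
   Phi j x *m invmx Gam *m (L (x *m g) *m invmx (Phi i (x *m g) *m L (x *m g)))).
  apply: regular_mx_atM.
    apply: regular_mx_atM; last exact: regular_mx_at_const.
    have /regular_mxP /(_ _ dj0) r := Phi_reg (i := j).
    by move=> a b; apply: regular_at_sub (r a b) => x [].
  have r := regular_mx_atM rL rV.
  by move=> a b; apply: regular_at_sub (regular_at_lin (r a b)) => x [].
(* The last factor is 1 where the coordinate is nonzero and 0 elsewhere, since division by 0 gives
   0; it expresses this condition by a function of degree 0. *)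
pose u (y : 'rV[C]_4) := (\det (Ah y *m G) * \det (Phi i y *m L y)) * (y 0 l / y 0 l).
move=> a b; apply: (regular_at_near (u := fun x => u (x *m g)) _ _ _ _ (rR a b)) => //.
- apply: (regular_at_sub (D := fun x => Dy (x *m g))); first by move=> x [].
  apply: (regular_at_lin (h := u)); apply: regular_atM.
    by apply: regular_atM; apply: regular_at_det.
  exact: regular_at_coord_div.
- by rewrite /u -/y0 hG L0 pl !det1 !mul1r divff ?oner_neq0.
move=> x [dj di]; rewrite /u; set y := x *m g in di *.
rewrite !mulf_eq0 !negb_or -!andbA => /and4P[d1 d2 yl _].
congr (fun M : 'M_2 => M a b).
have uP : Phi i y *m L y \in unitmx by rewrite unitmxE unitfE.
have uA : Ah y *m G \in unitmx by rewrite unitmxE unitfE.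
rewrite mulmxA; apply: (canLR (mulmxK uP)); apply: mulmx_cV_inj => v.
rewrite -(mulmxA (sym_map j i x)) -(mulmxA (Phi i y)) sym_mapE //.
  by rewrite !mulmxA.
by rewrite mulmxA AL // mul0mx.
Qed.

Lemma sym_bundle_iso : bundle_iso (pull g E) E.
Proof.
exists (fun j i x => sym_map j i x).
have domE i x : dom (E := pull g E) i x <-> dom (E := E) i (x *m g).
  by rewrite /dom -meval_lin_subst.
split.
- move=> j i a b x0 [d1 /domE d2].
  have [d [e [P [Q [h1 h2 h3 h4 h5]]]]] := @sym_map_regular j i a b x0 (conj d1 d2).
  by exists d, e, P, Q; split=> // x [dj /domE di]; apply: h5.
- by move=> j i x dj /domE; apply: sym_map_unit.
by move=> j j' i i' x dj dj' /domE di /domE di'; apply: sym_map_trans.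
Qed.

End BundleIso.

(** * Zariski closed and irreducible sets of matrices *)

Lemma mpoly_ring_ind (C : fieldType) (n : nat) (K : {mpoly C[n]} -> Prop) :
  (forall c, K c%:MP) -> (forall i, K 'X_i) ->
  (forall p q, K p -> K q -> K (p + q)) ->
  (forall p q, K p -> K q -> K (p * q)) -> forall p, K p.
Proof.
move=> hC hX hD hM; elim/mpolyind => [|c m p _ _ Kp].
  by rewrite -mpolyC0; apply: hC.
apply: hD => //; rewrite -mul_mpolyC; apply: (hM) => //.
rewrite mpolyXE_id; apply: big_ind => [||i _]; [exact: (hC 1)|exact: hM|].
by elim: (m i) => [|e IH]; rewrite ?exprS; [apply: (hC 1)|apply: (hM)].
Qed.

Definition polynomial_map (C : fieldType) (m n p q : nat)
    (f : 'M[C]_(m, n) -> 'M[C]_(p, q)) : Prop :=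
  forall i j, exists P : {mpoly C[m * n]}, forall M, f M i j = meval_mx P M.

Section PolynomialMap.
Variable C : fieldType.

Lemma meval_mxXU (m n : nat) (i : 'I_m) (j : 'I_n) (M : 'M[C]_(m, n)) :
  meval_mx 'X_(mxvec_index i j) M = M i j.
Proof. by rewrite /meval_mx mevalXU mxvecE. Qed.

Lemma polynomial_map_const m n p q (N : 'M[C]_(p, q)) :
  polynomial_map (fun _ : 'M[C]_(m, n) => N).
Proof. by move=> i j; exists (N i j)%:MP => M; rewrite /meval_mx mevalC. Qed.

Lemma polynomial_map_id m n : polynomial_map (fun M : 'M[C]_(m, n) => M).
Proof. by move=> i j; exists 'X_(mxvec_index i j) => M; rewrite meval_mxXU. Qed.

Lemma polynomial_mapM m n p q r (f : 'M[C]_(m, n) -> 'M[C]_(p, q))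
    (g : 'M[C]_(m, n) -> 'M[C]_(q, r)) :
  polynomial_map f -> polynomial_map g ->
  polynomial_map (fun M => f M *m g M).
Proof.
move=> hf hg i j.
have /fin_all_exists[F hF] := hf i.
have /fin_all_exists[G hG] : forall l, exists P, forall M, g M l j = meval_mx P M.
  by move=> l; apply: hg.
exists (\sum_l F l * G l) => M; rewrite mxE /meval_mx raddf_sum /=.
by apply: eq_bigr => l _; rewrite mevalM hF hG.
Qed.

Lemma polynomial_map_tens m n p q r s (f : 'M[C]_(m, n) -> 'M[C]_(p, q))
    (g : 'M[C]_(m, n) -> 'M[C]_(r, s)) :
  polynomial_map f -> polynomial_map g ->
  polynomial_map (fun M => f M *t g M).
Proof.
move=> hf hg i j; case: (mxtens_indexP i) => i1 i2; case: (mxtens_indexP j) => j1 j2.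
have [P hP] := hf i1 j1; have [Q hQ] := hg i2 j2.
by exists (P * Q) => M; rewrite tensmxE /meval_mx mevalM hP hQ.
Qed.

Lemma meval_mx_comp m n p q (f : 'M[C]_(m, n) -> 'M[C]_(p, q))
    (P : {mpoly C[p * q]}) :
  polynomial_map f -> exists Q, forall M, meval_mx P (f M) = meval_mx Q M.
Proof.
move=> hf.
have /fin_all_exists[F hF] : forall l : 'I_(p * q), exists Q : {mpoly C[m * n]},
    forall M, mxvec (f M) 0 l = meval_mx Q M.
  by case/mxvec_indexP => i j; have [Q hQ] := hf i j; exists Q => M; rewrite mxvecE.
exists (P \mPo [tuple F l | l < p * q]) => M.
rewrite /meval_mx comp_mpoly_meval; apply: meval_eq => l.
by rewrite tnth_mktuple hF.
Qed.

Lemma zclosed_preim m n p q (f : 'M[C]_(m, n) -> 'M[C]_(p, q)) Z :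
  polynomial_map f -> zclosed Z -> zclosed (fun M => Z (f M)).
Proof.
move=> hf [S hS].
exists (fun Q => exists2 P, S P & forall M, meval_mx P (f M) = meval_mx Q M) => M.
rewrite hS; split=> [h Q [P SP <-]|h P SP]; first exact: h.
by have [Q hQ] := meval_mx_comp P hf; rewrite hQ; apply: h; exists P.
Qed.

Lemma zclosedI m n (Z1 Z2 : 'M[C]_(m, n) -> Prop) :
  zclosed Z1 -> zclosed Z2 -> zclosed (fun M => Z1 M /\ Z2 M).
Proof.
move=> [S1 h1] [S2 h2]; exists (fun P => S1 P \/ S2 P) => M; rewrite h1 h2.
split=> [[a b] P [/a|/b] //|h].
by split=> P SP; apply: h; [left|right].
Qed.

Lemma zclosed_eq m n p q (f g : 'M[C]_(m, n) -> 'M[C]_(p, q)) :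
  polynomial_map f -> polynomial_map g -> zclosed (fun M => f M = g M).
Proof.
move=> hf hg.
exists (fun Q => exists i j, forall M, f M i j - g M i j = meval_mx Q M) => M.
split=> [e Q [i [j <-]]|h]; first by rewrite e subrr.
apply/matrixP => i j; apply/eqP; rewrite -subr_eq0; apply/eqP.
have [P hP] := hf i j; have [Q hQ] := hg i j.
have e N : f N i j - g N i j = meval_mx (P - Q) N.
  by rewrite hP hQ /meval_mx mevalB.
by rewrite e; apply: h; exists i, j.
Qed.

Lemma eq_zclosed m n (Z Z' : 'M[C]_(m, n) -> Prop) :
  (forall M, Z M <-> Z' M) -> zclosed Z -> zclosed Z'.
Proof. by move=> e [S h]; exists S => M; rewrite -e h. Qed.

Lemma zirreducible_image m n p q (f : 'M[C]_(m, n) -> 'M[C]_(p, q))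
    (X : 'M[C]_(m, n) -> Prop) :
  polynomial_map f -> zirreducible X ->
  zirreducible (fun N => exists2 M, X M & N = f M).
Proof.
move=> hf [[M0 X0] irr]; split; first by exists (f M0), M0.
move=> Z1 Z2 c1 c2 cov.
have [] := irr _ _ (zclosed_preim hf c1) (zclosed_preim hf c2).
- by move=> M XM; apply: cov; exists M.
- by left=> _ [M XM ->]; auto.
by right=> _ [M XM ->]; auto.
Qed.

Lemma zirreducible_connected m n (X : 'M[C]_(m, n) -> Prop) :
  zirreducible X -> zconnected X.
Proof.
move=> [_ irr] Z1 Z2 c1 c2 cov [M1 X1 z1] [M2 X2 z2].
by have [h|h] := irr _ _ c1 c2 cov; [exists M2 | exists M1]; auto.
Qed.

Lemma zirreducible_set1 m n (M0 : 'M[C]_(m, n)) : zirreducible (fun M => M = M0).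
Proof.
split; first by exists M0.
by move=> Z1 Z2 _ _ /(_ _ erefl)[h|h]; [left|right] => _ ->.
Qed.

End PolynomialMap.

(** In characteristic zero the natural numbers below [size p] are distinct, too many to be all
    roots. *)
Lemma poly_nonroot (C : numDomainType) (p : {poly C}) :
  p != 0 -> exists t, p.[t] != 0.
Proof.
move=> p0; pose rs := [seq i%:R : C | i <- iota 0 (size p)].
have [/allP h|/allPn[t _ ht]] := boolP (all (root p) rs); last by exists t.
have u : uniq rs.
  by rewrite map_inj_uniq ?iota_uniq // => a b /eqP; rewrite eqr_nat => /eqP.
have := max_poly_roots p0 (introT allP h) u.
by rewrite size_map size_iota ltnn.
Qed.

(** Multiplied by a power of [h], a polynomial restricted to the curve becomes a polynomial in the
    parameter, and these form a domain. The denominator [h] is there for the torus, whose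
    parametrization contains the inverse of t. *)
Lemma zirreducible_curve (C : numFieldType) (m n : nat) (h : {poly C})
    (gam : C -> 'M[C]_(m, n)) :
  h != 0 ->
  (forall i j, exists a : {poly C}, forall t, h.[t] != 0 ->
     h.[t] * gam t i j = a.[t]) ->
  zirreducible (fun M => exists2 t, h.[t] != 0 & M = gam t).
Proof.
move=> h0 ha.
have [t0 ht0] := poly_nonroot h0.
split; first by exists (gam t0), t0.
have clear_denom P : exists N (f : {poly C}), forall t, h.[t] != 0 ->
    h.[t] ^+ N * meval_mx P (gam t) = f.[t].
  elim/mpoly_ring_ind: P => [c|l|P Q [N [f hf]] [N' [f' hf']]|P Q [N [f hf]] [N' [f' hf']]].
  - by exists 0%N, c%:P => t _; rewrite /meval_mx mevalC mul1r hornerC.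
  - case/mxvec_indexP: l => i j; have [a ha'] := ha i j.
    by exists 1%N, a => t ht; rewrite meval_mxXU expr1 ha'.
  - exists (N + N')%N, (f * h ^+ N' + f' * h ^+ N) => t ht.
    rewrite /meval_mx mevalD !hornerE -hf // -hf' // exprD /meval_mx.
    by ring.
  exists (N + N')%N, (f * f') => t ht.
  by rewrite /meval_mx mevalM hornerM -hf // -hf' // exprD mulrACA.
move=> Z1 Z2 [S1 h1] [S2 h2] cov.
have [all1|] := boolp.EM (forall M, (exists2 t, h.[t] != 0 & M = gam t) -> Z1 M).
  by left.
move=> /boolp.existsNP[_ /boolp.not_implyP[[t1 ht1 ->]]].
rewrite h1 => /boolp.existsNP[P1 /boolp.not_implyP[SP1 P1t]].
right=> _ [t ht ->]; apply/h2 => P2 SP2.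
have [N1 [f1 hf1]] := clear_denom P1; have [N2 [f2 hf2]] := clear_denom P2.
have f10 : f1 != 0.
  apply/eqP => f10; apply: P1t; have /eqP := hf1 _ ht1.
  by rewrite f10 horner0 mulf_eq0 expf_eq0 (negPf ht1) andbF => /eqP.
apply/eqP; have : f2 = 0.
  apply/eqP; apply: contraT => f20.
  (* At such a parameter [P1] and [P2] are both nonzero, so the point of the curve lies in neither
     closed set. *)
  have [u] := poly_nonroot (mulf_neq0 (mulf_neq0 f10 f20) h0).
  rewrite !hornerM !mulf_eq0 !negb_or -andbA => /and3P[u1 u2 hu].
  have [] := cov (gam u); first by exists u.
    move/h1/(_ _ SP1) => e; move: u1.
    by rewrite -hf1 // e mulr0 eqxx.
  move/h2/(_ _ SP2) => e; move: u2.
  by rewrite -hf2 // e mulr0 eqxx.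
move=> f20; have /eqP := hf2 _ ht.
by rewrite f20 horner0 mulf_eq0 expf_eq0 (negPf ht) andbF.
Qed.

(** * Subgroups of SL(U') acting on U (x) U' *)

Lemma sympow1 (C : fieldType) (m : nat) : sympow m (1%:M : 'M[C]_2) = 1%:M.
Proof.
apply/matrixP => i j; rewrite !mxE /= scale0r addr0 scale1r polyC0 add0r.
by rewrite expr1n mul1r coefXn.
Qed.

(** Laplace expansion along the first two rows: the products of complementary minors form the
    Pluecker pairing of the first two rows with the last two. *)
Lemma det_matrix4 (C : comRingType) (f : nat -> nat -> C) :
  \det (\matrix_(i < 4, j < 4) f i j) =
    (f 0 0 * f 1 1 - f 0 1 * f 1 0) * (f 2 2 * f 3 3 - f 2 3 * f 3 2)
  - (f 0 0 * f 1 2 - f 0 2 * f 1 0) * (f 2 1 * f 3 3 - f 2 3 * f 3 1)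
  + (f 0 0 * f 1 3 - f 0 3 * f 1 0) * (f 2 1 * f 3 2 - f 2 2 * f 3 1)
  + (f 0 1 * f 1 2 - f 0 2 * f 1 1) * (f 2 0 * f 3 3 - f 2 3 * f 3 0)
  - (f 0 1 * f 1 3 - f 0 3 * f 1 1) * (f 2 0 * f 3 2 - f 2 2 * f 3 0)
  + (f 0 2 * f 1 3 - f 0 3 * f 1 2) * (f 2 0 * f 3 1 - f 2 1 * f 3 0) :> C.
Proof.
do 3!rewrite !(expand_det_row _ ord0) !big_ord_recl !big_ord0 /cofactor.
rewrite !det_mx11 !mxE /= /bump /=.
rewrite !expr0 !add0n !addn0 /=.
ring.
Qed.

Lemma tens11 (C : fieldType) (m n : nat) :
  (1%:M : 'M[C]_m) *t (1%:M : 'M[C]_n) = 1%:M.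
Proof.
apply/matrixP => i j; case: (mxtens_indexP i) => i1 i2.
case: (mxtens_indexP j) => j1 j2; rewrite tensmxE !mxE -natrM mulnb.
by rewrite (can_eq (@mxtens_indexK m n)) xpair_eqE.
Qed.

Lemma det_tens1 (C : fieldType) (a : 'M[C]_2) :
  \det ((1%:M : 'M[C]_2) *t a) = \det a ^+ 2.
Proof.
pose f (i j : nat) : C := (i %/ 2 == j %/ 2)%N%:R * a (inord (i %% 2)%N) (inord (j %% 2)%N).
have -> : (1%:M : 'M[C]_2) *t a = (\matrix_(i < 4, j < 4) f i j : 'M_(2 * 2)).
  apply/matrixP => i j; rewrite !mxE /f -val_eqE /=; congr (_ * a _ _);
  by apply: val_inj; rewrite /= inordK // ltn_mod.
rewrite det_matrix4 /f /= !mul1r !mul0r.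
rewrite (expand_det_row _ ord0) !big_ord_recl big_ord0 /cofactor !det_mx11 !mxE /=.
have -> : (0 %% 2 = 0)%N by [].
have -> : (1 %% 2 = 1)%N by [].
have -> : inord 0 = ord0 :> 'I_2 by apply: val_inj; rewrite /= inordK.
have -> : lift ord0 ord0 = inord 1 :> 'I_2 by apply: val_inj; rewrite /= inordK.
have -> : lift (inord 1) 0 = ord0 :> 'I_2 by apply: val_inj; rewrite /= inordK.
rewrite /= expr0 expr1.
ring.
Qed.

Section TorusLike.
Variables (C : numFieldType) (tau : 'M[C]_(2 * 2)) (H : 'M[C]_2 -> Prop).
Hypothesis tau_unit : tau \in unitmx.
Hypothesis H1 : H 1%:M.
Hypothesis HM : forall a b, H a -> H b -> H (a *m b).
Hypothesis HV : forall a, H a -> H (invmx a).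
Hypothesis Hdet : forall a, H a -> \det a = 1.
Hypothesis Hclosed : zclosed H.
Hypothesis Hirr : zirreducible H.
Hypothesis Hnontriv : exists2 a, H a & a != 1%:M.

Definition tens_group (g : 'M[C]_4) : Prop :=
  exists2 a, H a & g = tau *m (1%:M *t a) *m invmx tau.

(** The first diagonal block in the tensor basis: a polynomial map that recovers [a] from its image
    in the group. It serves both as [rho'] and to show that the group is closed, as the set of [g]
    with factor in [H] that are rebuilt from their factor. *)
Definition tens_factor (g : 'M[C]_4) : 'M[C]_2 :=
  \matrix_(i, j) (invmx tau *m g *m tau : 'M_(2 * 2))
     (mxtens_index (0, i)) (mxtens_index (0, j)).

Lemma tens_factorE a : tens_factor (tau *m (1%:M *t a) *m invmx tau) = a.
Proof.
apply/matrixP => i j; rewrite mxE !mulmxA mulVmx // mul1mx mulmxKV // tensmxE.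
by rewrite mxE mul1r.
Qed.

Lemma tens_factor_polynomial : polynomial_map tens_factor.
Proof.
move=> i j.
have [P hP] : exists P : {mpoly C[4 * 4]}, forall M : 'M[C]_4,
    (invmx tau *m M *m tau) (mxtens_index (0, i)) (mxtens_index (0, j)) = meval_mx P M.
  have h : polynomial_map (fun M : 'M[C]_4 => invmx tau *m M *m tau).
    apply: polynomial_mapM; last exact: polynomial_map_const.
    by apply: polynomial_mapM; [apply: polynomial_map_const | apply: polynomial_map_id].
  exact: (h (mxtens_index (0, i)) (mxtens_index (0, j))).
by exists P => M; rewrite mxE.
Qed.

Lemma tens_conj_polynomial :
  polynomial_map (fun a : 'M[C]_2 => tau *m (1%:M *t a) *m invmx tau : 'M[C]_4).
Proof.
apply: polynomial_mapM; last exact: polynomial_map_const.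
apply: polynomial_mapM; first exact: polynomial_map_const.
by apply: polynomial_map_tens; [apply: polynomial_map_const | apply: polynomial_map_id].
Qed.

Lemma H_unit a : H a -> a \in unitmx.
Proof. by move/Hdet => d; rewrite unitmxE d unitr1. Qed.

Lemma tens_conjM a b : tau *m ((1%:M : 'M_2) *t (a *m b : 'M_2)) *m invmx tau =
  (tau *m (1%:M *t a) *m invmx tau) *m (tau *m (1%:M *t b) *m invmx tau).
Proof. by rewrite !mulmxA mulmxKV // -[in LHS](mulmx1 1%:M) -tensmx_mul !mulmxA. Qed.

Lemma tens_conj1 : tau *m ((1%:M : 'M_2) *t (1%:M : 'M_2)) *m invmx tau = 1%:M.
Proof.
by rewrite tens11 mulmx1 mulmxV.
Qed.

Lemma tens_group_zclosed : zclosed tens_group.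
Proof.
apply: (eq_zclosed (Z := fun g => H (tens_factor g) /\
   tau *m (1%:M *t tens_factor g) *m invmx tau = g)).
  move=> g; split=> [[Hg e]|[a Ha ->]]; first by exists (tens_factor g).
  by rewrite tens_factorE.
apply: zclosedI; first exact: zclosed_preim tens_factor_polynomial Hclosed.
apply: zclosed_eq; last exact: polynomial_map_id.
move=> i j; have [P hP] := tens_conj_polynomial i j.
have [Q hQ] := meval_mx_comp P tens_factor_polynomial.
by exists Q => M; rewrite -hQ -hP.
Qed.

Lemma tens_group_zirreducible : zirreducible tens_group.
Proof. exact: zirreducible_image tens_conj_polynomial Hirr. Qed.

Lemma tens_group1 : tens_group 1%:M.
Proof. by exists 1%:M; rewrite ?tens_conj1. Qed.

Lemma tens_group_unit g : tens_group g -> g \in unitmx.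
Proof.
move=> [a Ha ->]; rewrite unitmxE !det_mulmx det_inv mulrAC unitrM.
have ut : \det tau \is a GRing.unit by rewrite -unitmxE.
by rewrite unitrM ut unitrV ut det_tens1 Hdet // expr1n unitr1.
Qed.

Lemma tens_group_det g : tens_group g -> \det g = 1.
Proof.
move=> [a Ha ->]; rewrite !det_mulmx det_inv mulrAC mulfV ?mul1r.
  by rewrite det_tens1 Hdet // expr1n.
by rewrite -unitfE -unitmxE.
Qed.

Lemma tens_group_closed_subgroup : closed_subgroup tens_group.
Proof.
split.
- exact: tens_group_unit.
- exact: tens_group1.
- move=> g h [a Ha ->] [b Hb ->]; exists (a *m b); first exact: HM.
  by rewrite tens_conjM.
- move=> g Gg; have ug := tens_group_unit Gg; case: Gg ug => a Ha -> ug.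
  exists (invmx a); first exact: HV.
  rewrite -[LHS]mulmx1; apply: (canLR (mulKmx ug)).
  by rewrite -tens_conjM mulmxV ?tens_conj1 ?H_unit.
exists tens_group; first exact: tens_group_zclosed.
by move=> g; split=> [Gg|[]] //; split=> //; apply: tens_group_unit.
Qed.

Lemma tens_group_positive_dim : positive_dim tens_group.
Proof.
exists (fun M => M = 1%:M), tens_group; split=> //.
- split; last exact: zirreducible_set1.
  by apply: zclosed_eq; [apply: polynomial_map_id | apply: polynomial_map_const].
- by split; [apply: tens_group_zclosed | apply: tens_group_zirreducible].
- by move=> M ->; apply: tens_group1.
have [a Ha a1] := Hnontriv.
exists (tau *m (1%:M *t a) *m invmx tau); first by exists a.
move=> e; move/eqP: a1; apply.
by rewrite -[LHS]tens_factorE e -tens_conj1 tens_factorE.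
Qed.

End TorusLike.

(** A subgroup of SL(U') whose lifted action fixes A has a fine action with trivial [rho]; its
    elements are symmetries of E because a symmetry of the monad induces an isomorphism of
    bundles. *)
Lemma fine_subgroup (C : numFieldType) (k : nat) (E : bundle_data C 2)
    (J : 'M[C]_(k.+1 * 2)) (A : 'I_4 -> 'M[C]_(k, k.+1 * 2))
    (tau : 'M[C]_(2 * 2)) (beta : 'M[C]_(k.+1 * 2)) (H : 'M[C]_2 -> Prop) :
  is_bundle E -> represents J A E -> tau \in unitmx -> beta \in unitmx ->
  H 1%:M -> (forall a b, H a -> H b -> H (a *m b)) ->
  (forall a, H a -> H (invmx a)) -> (forall a, H a -> \det a = 1) ->
  zclosed H -> zirreducible H -> (exists2 a, H a & a != 1%:M) ->
  (forall a, H a ->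
     let gW := beta *m ((1%:M : 'M_k.+1) *t a) *m invmx beta in
     gW^T *m J *m gW = J /\
     forall i, \sum_j (tau *m ((1%:M : 'M_2) *t a) *m invmx tau : 'M_4) i j
                 *: (A j *m gW^T) = A i) ->
  exists G : 'M[C]_4 -> Prop,
    [/\ closed_subgroup G, forall g, G g -> Sym0 E g, positive_dim G
      & fine_action k E G].
Proof.
move=> bE repA utau ubeta H1 HM HV Hdet Hcl Hirr Hnt equi.
have symE g : tens_group tau H g -> Sym E g.
  move=> Gg; split; first exact: tens_group_det Gg.
  case: Gg => a Ha ->; have [sym eqA] := equi a Ha.
  have [monadA [Phi [Phi_reg Phi_trans Phi_surj Phi_ker]]] := repA.
  set gW := _ *m invmx beta in sym eqA; set g0 := _ *m invmx tau in eqA *.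
  apply: (sym_bundle_iso bE monadA Phi_reg Phi_trans Phi_surj Phi_ker (Gam := gW^T)).
    by rewrite trmxK.
  move=> x; rewrite /monad_map mulmx_suml.
  under eq_bigr do rewrite -eqA scaler_sumr.
  rewrite exchange_big; apply: eq_bigr => j _ /=.
  rewrite mxE -scalemxAl scaler_suml; apply: eq_bigr => i _.
  by rewrite scalerA.
exists (tens_group tau H); split.
- exact: tens_group_closed_subgroup.
(* The group itself, being irreducible, is the connected set joining [g] to 1. *)
- move=> g Gg; exists (tens_group tau H); split=> //; last exact: tens_group1.
  exact/zirreducible_connected/tens_group_zirreducible.
- exact: tens_group_positive_dim.
(* Since [rho] is trivial, so are its symmetric powers; the action on I is the identity and [gamma]
   is arbitrary. *)
exists tau, beta, 1%:M, (fun=> 1%:M), (tens_factor tau); split.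
- by split=> //; apply: unitmx1.
- move=> i j; have [P hP] := tens_factor_polynomial tau i j.
  exists ((1%:M : 'M[C]_2) i j)%:MP, P => g _; split=> //.
  by rewrite /meval_mx mevalC.
- move=> _ [a Ha ->]; rewrite tens_factorE //; split; first exact: unitmx1.
  by rewrite unitmxE Hdet // unitr1.
- move=> _ _ [a Ha ->] [b Hb ->]; rewrite mulmx1.
  by rewrite -tens_conjM // !tens_factorE.
split; first by move=> _ [a Ha ->]; rewrite tens_factorE.
exists J, A; split=> // _ [a Ha ->]; rewrite tens_factorE //.
rewrite !sympow1 invmx1 !mulmx1; have [sym eqA] := equi a Ha; split=> // i.
by rewrite -[RHS]eqA; apply: eq_bigr => j _; rewrite mul1mx.
Qed.

(** * Pencils of matrices *)

Section Pencils.
Variable C : numClosedFieldType.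

Lemma eigenvector_exists (n : nat) (M : 'M[C]_n) :
  (0 < n)%N -> exists2 v : 'rV_n, v != 0 & exists a, v *m M = a *: v.
Proof.
move=> n0; have /closed_rootP[a] : size (char_poly M) != 1%N.
  by rewrite size_char_poly eqSS -lt0n.
rewrite -eigenvalue_root_char => /eigenvalueP[v vM v0].
by exists v => //; exists a.
Qed.

(** As [Y] is injective, X followed by the inverse of Y is an endomorphism of the row space of [T];
    [v] is an eigenvector of it. *)
Lemma pencil_eigenvector (r n q : nat) (T : 'M[C]_(r, n)) (X Y : 'M[C]_(n, q)) :
  T != 0 -> (T *m X <= T *m Y)%MS -> row_free Y ->
  exists v : 'rV_n,
    [/\ v != 0, (v <= T)%MS & exists a, v *m X = a *: (v *m Y)].
Proof.
move=> T0 sTXY freeY; pose U := row_base T.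
have /submxP[K hK] : (U *m X <= U *m Y)%MS.
  apply: (submx_trans (submxMr X _) (submx_trans sTXY (submxMr Y _)));
  by rewrite eq_row_base.
have [|w w0 [a wK]] := eigenvector_exists K; first by rewrite lt0n mxrank_eq0.
exists (w *m U); split; last 2 first.
- by rewrite (submx_trans (submxMl _ _)) // eq_row_base.
- by exists a; rewrite -mulmxA hK (mulmxA w) wK -scalemxAl mulmxA.
  apply: contraNneq w0 => wU; apply/eqP/(row_free_inj (row_base_free T)).
  by rewrite mul0mx.
Qed.

Definition free_pencil (m n : nat) (X Y : 'M[C]_(m, n)) : Prop :=
  forall a b, (a, b) != (0, 0) -> row_free (a *: X + b *: Y).

Lemma free_pencil_no_eigenvector (m n : nat) (X Y : 'M[C]_(m, n)) a b
    (v : 'rV_m) :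
  free_pencil X Y -> (a, b) != (0, 0) -> v *m (a *: X + b *: Y) = 0 -> v = 0.
Proof.
by move=> h /h/row_free_inj inj vM; apply: inj; rewrite vM mul0mx.
Qed.

(** If the rank were m, the row space of X would lie in that of Y, and an eigenvector would make
    some X - a Y singular. *)
Lemma free_pencil_rank (m n : nat) (X Y : 'M[C]_(m, n)) :
  (0 < m)%N -> free_pencil X Y -> (m < \rank (X + Y)%MS)%N.
Proof.
move=> m0 hXY; rewrite ltnNge; apply/negP => rk.
have freeY : row_free Y.
  have := hXY 0 1; rewrite scale0r add0r scale1r; apply.
  by rewrite xpair_eqE oner_eq0 andbF.
have sXY : (X <= Y)%MS.
  apply: submx_trans (addsmxSl X Y) _.
  by rewrite -(mxrank_leqif_sup (addsmxSr X Y)) eqn_leq mxrankS ?addsmxSr //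
     (eqP freeY) rk.
have one0 : (1%:M : 'M[C]_m) != 0.
  by case: m m0 {X Y hXY rk freeY sXY} => // m _; apply: matrix_nonzero1.
have [||v [v0 _ [a ha]]] := @pencil_eigenvector m m n 1%:M X Y one0.
- by rewrite !mul1mx.
- by [].
move/eqP: v0; apply.
apply: (free_pencil_no_eigenvector (a := 1) (b := - a) hXY).
  by rewrite xpair_eqE oner_eq0.
by rewrite scale1r scaleNr mulmxBr -scalemxAr ha subrr.
Qed.

(** Take preimages [u i] of [e] under X + i Y. In dimension m they become dependent, and their span
    is then stable in the sense of [pencil_eigenvector], which produces a singular member of the
    pencil unless [e = 0]. *)
Lemma free_pencil_common_row (m n : nat) (X Y : 'M[C]_(m, n)) (e : 'rV_n) :
  free_pencil X Y -> (forall t : C, (e <= (X + t *: Y)%R)%MS) -> e = 0.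
Proof.
move=> hXY he; apply/eqP; apply: contraT => e0.
pose u (i : nat) := e *m pinvmx (X + i%:R *: Y).
have uE (i : nat) : u i *m (X + i%:R *: Y) = e by apply: mulmxKpV.
pose S (j : nat) := (\sum_(i < j) <<u i>>)%MS.
have [j hj] : exists j, (u j <= S j)%MS.
  apply: boolp.contrapT => /boolp.forallNP H.
  have rk j : (j <= \rank (S j))%N.
    elim: j => // j IH; rewrite /S big_ord_recr /= -/(S j).
    apply: leq_ltn_trans IH _; rewrite ltn_neqAle mxrankS ?addsmxSl // andbT.
    rewrite (mxrank_leqif_sup (addsmxSl _ _)) addsmx_sub submx_refl genmxE.
    exact/negP/H.
  by have := leq_trans (rk m.+1) (rank_leq_col _); rewrite ltnn.
have S0 : S j != 0.
  apply: contraNneq e0 => Sj; rewrite -(uE j).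
  by move: hj; rewrite Sj submx0 => /eqP ->; rewrite mul0mx.
have freeX : row_free (X + j%:R *: Y).
  by rewrite -[X]scale1r; apply: hXY; rewrite xpair_eqE oner_eq0.
have sub : (S j *m Y <= S j *m (X + j%:R *: Y)%R)%MS.
  rewrite {1}/S sumsmxMr_gen; apply/sumsmx_subP => i _; rewrite genmxE.
  have hi : (u i <= S j)%MS.
    by apply: submx_trans (sumsmx_sup i _ (submx_refl _)) => //; rewrite genmxE.
  have d0 : (j%:R - i%:R : C) != 0.
    by rewrite subr_eq0 eqr_nat gtn_eqF.
  (* Both [u i] under X + i Y and [u j] under X + j Y give [e], so only a multiple of [u i *m Y]
     survives. *)
  have eq1 : (u i - u j) *m (X + j%:R *: Y) = (j%:R - i%:R) *: (u i *m Y).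
    rewrite mulmxBl uE -(uE i) -mulmxBr opprD addrACA subrr add0r -scalerBl.
    by rewrite scalemxAr.
  rewrite (eqmxMr _ (genmxE _)).
  rewrite -(eqmx_scale (u i *m Y) d0) -eq1.
  by apply: submxMr; rewrite addmx_sub ?eqmx_opp.
have [v [v0 _ [a ha]]] := pencil_eigenvector S0 sub freeX.
case/negP: v0; apply/eqP.
apply: (free_pencil_no_eigenvector (a := - a) (b := 1 - a * j%:R) hXY).
  rewrite xpair_eqE oppr_eq0; apply/negP => /andP[/eqP ->].
  by rewrite mul0r subr0 oner_eq0.
rewrite scalerBl scale1r addrCA scaleNr -opprD -scalerA -scalerDr.
by rewrite mulmxBr ha -scalemxAr subrr.
Qed.

End Pencils.

(** * The monad and its jumping lines *)

Section MonadAlgebra.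
Variables (C : numClosedFieldType) (k : nat).
Variables (J : 'M[C]_(k.+1 * 2)) (A : 'I_4 -> 'M[C]_(k, k.+1 * 2)).

Lemma monad_mapD x y : monad_map A (x + y) = monad_map A x + monad_map A y.
Proof.
by rewrite -big_split; apply: eq_bigr => i _; rewrite mxE scalerDl.
Qed.

Lemma monad_mapZ a x : monad_map A (a *: x) = a *: monad_map A x.
Proof.
by rewrite scaler_sumr; apply: eq_bigr => i _; rewrite mxE scalerA.
Qed.

Lemma monad_map_delta i : monad_map A (delta_mx 0 i) = A i.
Proof.
rewrite /monad_map (bigD1 i) //= big1 => [|j ji]; rewrite mxE eqxx /=.
  by rewrite eqxx scale1r addr0.
by rewrite (negPf ji) scale0r.
Qed.

Definition jump_mx (x y : 'rV[C]_4) : 'M[C]_k :=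
  monad_map A x *m J *m (monad_map A y)^T.

Lemma jump_mxDl x x' y : jump_mx (x + x') y = jump_mx x y + jump_mx x' y.
Proof. by rewrite /jump_mx monad_mapD !mulmxDl. Qed.

Lemma jump_mxDr x y y' : jump_mx x (y + y') = jump_mx x y + jump_mx x y'.
Proof. by rewrite /jump_mx monad_mapD linearD mulmxDr. Qed.

Lemma jump_mxZl a x y : jump_mx (a *: x) y = a *: jump_mx x y.
Proof. by rewrite /jump_mx monad_mapZ -!scalemxAl. Qed.

Lemma jump_mxZr a x y : jump_mx x (a *: y) = a *: jump_mx x y.
Proof. by rewrite /jump_mx monad_mapZ linearZ /= -scalemxAr. Qed.

Hypothesis monadA : monad J A.

Lemma jump_mxx x : jump_mx x x = 0.
Proof. exact: monad_complex monadA x. Qed.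

Lemma jump_mxC x y : jump_mx y x = - jump_mx x y.
Proof.
apply/eqP; rewrite -addr_eq0 addrC; apply/eqP.
by have := jump_mxx (x + y);
  rewrite jump_mxDl !jump_mxDr !jump_mxx add0r addr0.
Qed.

(** Transposition exchanges [x] and [y] and replaces J by - J; each contributes a sign. *)
Lemma trmx_jump_mx x y : (jump_mx x y)^T = jump_mx x y.
Proof.
rewrite /jump_mx !trmx_mul trmxK (monad_skew monadA) mulNmx mulmxN mulmxA.
by rewrite -/(jump_mx y x) jump_mxC opprK.
Qed.

Lemma monad_free x : x != 0 -> row_free (monad_map A x).
Proof. by move=> x0; rewrite /row_free (monad_surj monadA x0). Qed.

Lemma monad_free_pencil x y :
  (forall a b, (a, b) != (0, 0) -> a *: x + b *: y != 0) ->
  free_pencil (monad_map A x) (monad_map A y).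
Proof.
move=> h a b /h ab; rewrite -!monad_mapZ -monad_mapD; exact: monad_free.
Qed.

End MonadAlgebra.

(** A [w] killed by every [A i] is a constant section of ker A; its image in E is a global section,
    hence 0. So [w] lies in im A^t at every point, and the points of one coordinate line already
    force [w = 0]. *)
Lemma monad_span (C : numClosedFieldType) (k : nat) (E : bundle_data C 2)
    (J : 'M[C]_(k.+1 * 2)) (A : 'I_4 -> 'M[C]_(k, k.+1 * 2))
    (w : 'cV[C]_(k.+1 * 2)) :
  is_bundle E -> h0_eq E 0 0 -> represents J A E ->
  (forall i, A i *m w = 0) -> w = 0.
Proof.
move=> bE [s [_ h0]] [monadA [Phi [Phi_reg Phi_trans _ Phi_ker]]] Aw.
have Aw' x : monad_map A x *m w = 0.
  by rewrite mulmx_suml big1 // => i _; rewrite -scalemxAl Aw scaler0.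
have sect : is_section (E := E) 0 (fun i x => Phi i x *m w).
  split=> [i|i j x di dj]; last exact: Phi_trans.
  apply/regular_mxP => x0 d0; apply: regular_mx_atM; last exact: regular_mx_at_const.
  by have /regular_mxP := Phi_reg i; apply.
have [c [hc _]] := h0 _ sect.
have e_sub x : x != 0 -> ((invmx J *m w)^T <= monad_map A x)%MS.
  move=> x0; have [i di] := chart_cover bE x0.
  have := hc i x di; rewrite big_ord0 => /(Phi_ker _ _ _ di (Aw' x)) [u ->].
  by rewrite -mulmxA mulKmx ?(monad_nondeg monadA) // trmx_mul trmxK submxMl.
pose x := delta_mx 0 0 : 'rV[C]_4; pose y := delta_mx 0 1 : 'rV[C]_4.
have indep a b : (a, b) != (0, 0) -> a *: x + b *: y != 0.
  apply: contraNneq => /rowP h; have := h 0; have := h 1.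
  by rewrite !mxE /= !mulr1 !mulr0 addr0 add0r => -> ->.
have : (invmx J *m w)^T = 0.
  apply: (free_pencil_common_row (monad_free_pencil monadA indep)) => t.
  rewrite -monad_mapZ -monad_mapD; apply: e_sub.
  by rewrite -[x]scale1r indep // xpair_eqE oner_eq0.
move/(congr1 trmx); rewrite trmxK trmx0 => e0.
by rewrite -[w](mulKVmx (monad_nondeg monadA)) e0 mulmx0.
Qed.

(** * One-parameter subgroups of SL_2 *)

Definition mx22 (C : fieldType) (a b c d : C) : 'M[C]_2 :=
  \matrix_(i < 2, j < 2)
    if i == 0 then (if j == 0 then a else b) else (if j == 0 then c else d).

Section Mx22.
Variable C : fieldType.

Lemma ord2P (P : 'I_2 -> Prop) : P 0 -> P 1 -> forall i, P i.
Proof.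
move=> P0 P1 [[|[|//]] h]; [move: P0|move: P1];
by congr P; apply: val_inj.
Qed.

Lemma mx22E (M : 'M[C]_2) : M = mx22 (M 0 0) (M 0 1) (M 1 0) (M 1 1).
Proof.
by apply/matrixP => i j; elim/ord2P: i; elim/ord2P: j; rewrite !mxE.
Qed.

Lemma mulmx22 a b c d a' b' c' d' :
  mx22 a b c d *m mx22 a' b' c' d' =
  mx22 (a * a' + b * c') (a * b' + b * d') (c * a' + d * c')
       (c * b' + d * d') :> 'M[C]_2.
Proof.
apply/matrixP => i j; rewrite !mxE !big_ord_recl big_ord0 !mxE addr0 /=.
by elim/ord2P: i; elim/ord2P: j.
Qed.

Lemma mx22_1 : mx22 1 0 0 1 = 1%:M :> 'M[C]_2.
Proof.
by apply/matrixP => i j; elim/ord2P: i; elim/ord2P: j; rewrite !mxE.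
Qed.

Lemma det_mx22 (M : 'M[C]_2) : \det M = M 0 0 * M 1 1 - M 0 1 * M 1 0.
Proof.
rewrite [M]mx22E (expand_det_row _ ord0) !big_ord_recl big_ord0 /cofactor.
by rewrite !det_mx11 !mxE /= expr0 expr1 addr0 mul1r mulN1r mulrN.
Qed.

Lemma entry_polynomial m n (i : 'I_m) (j : 'I_n) :
  polynomial_map (fun M : 'M[C]_(m, n) => (M i j)%:M : 'M_1).
Proof.
move=> a b; exists 'X_(mxvec_index i j) => M.
by rewrite meval_mxXU !ord1 mxE mulr1n.
Qed.

Definition unip22 (a : 'M[C]_2) : Prop := exists s, a = mx22 1 s 0 1.

Definition torus22 (a : 'M[C]_2) : Prop := exists2 t, t != 0 & a = mx22 t 0 0 t^-1.

Lemma unip22_1 : unip22 1%:M.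
Proof. by exists 0; rewrite mx22_1. Qed.

Lemma unip22_mul a b : unip22 a -> unip22 b -> unip22 (a *m b).
Proof.
move=> [s ->] [t ->]; exists (t + s).
by rewrite mulmx22 !mulr0 !mul0r !mulr1 !mul1r !addr0 add0r.
Qed.

Lemma invmx_mx22 (a b : 'M[C]_2) : a *m b = 1%:M -> invmx a = b.
Proof.
by move=> ab; have [ua _] := mulmx1_unit ab; rewrite -[RHS](mulKmx ua) ab mulmx1.
Qed.

Lemma unip22_inv a : unip22 a -> unip22 (invmx a).
Proof.
move=> [s ->]; exists (- s); apply: invmx_mx22.
by rewrite mulmx22 !mulr0 !mul0r !mulr1 !mul1r !addr0 add0r addNr mx22_1.
Qed.

Lemma unip22_det a : unip22 a -> \det a = 1.
Proof. by move=> [s ->]; rewrite det_mx22 !mxE /= mulr1 mulr0 subr0. Qed.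

Lemma unip22_closed : zclosed unip22.
Proof.
apply: (eq_zclosed (Z := fun a : 'M[C]_2 => ((a 0 0)%:M = 1%:M :> 'M_1 /\
    (a 1 1)%:M = 1%:M :> 'M_1) /\ (a 1 0)%:M = 0%:M :> 'M_1)).
  move=> a; split=> [[[e1 e2] e3]|[s ->]]; last by rewrite !mxE.
  exists (a 0 1); rewrite [LHS]mx22E.
  by congr mx22; [move: e1|move: e3|move: e2] => /matrixP/(_ 0 0); rewrite !mxE.
by do 2?apply: zclosedI; apply: zclosed_eq;
  (apply: entry_polynomial || apply: polynomial_map_const).
Qed.

Lemma torus22_1 : torus22 1%:M.
Proof. by exists 1; rewrite ?oner_neq0 // invr1 mx22_1. Qed.

Lemma torus22_mul a b : torus22 a -> torus22 b -> torus22 (a *m b).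
Proof.
move=> [s s0 ->] [t t0 ->]; exists (s * t); first by rewrite mulf_neq0.
by rewrite mulmx22 !mulr0 !mul0r !addr0 add0r invfM.
Qed.

Lemma torus22_inv a : torus22 a -> torus22 (invmx a).
Proof.
move=> [s s0 ->]; exists s^-1; rewrite ?invr_eq0 //; apply: invmx_mx22.
by rewrite mulmx22 !mulr0 !mul0r !addr0 add0r invrK mulfV // mulVf // mx22_1.
Qed.

Lemma torus22_det a : torus22 a -> \det a = 1.
Proof. by move=> [s s0 ->]; rewrite det_mx22 !mxE /= mulr0 subr0 mulfV. Qed.

Lemma torus22_closed : zclosed torus22.
Proof.
apply: (eq_zclosed (Z := fun a : 'M[C]_2 => ((a 0 1)%:M = 0%:M :> 'M_1 /\
    (a 0 0)%:M *m (a 1 1)%:M = 1%:M :> 'M_1) /\ (a 1 0)%:M = 0%:M :> 'M_1)).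
  move=> a; split=> [[[e1 e2] e3]|[s s0 ->]]; last first.
    by rewrite !mxE -scalar_mxM mulfV.
  move: e2; rewrite -scalar_mxM => /matrixP/(_ 0 0); rewrite !mxE !mulr1n => e2.
  have a0 : a 0 0 != 0.
    by apply/eqP => a0; move/eqP: e2; rewrite a0 mul0r eq_sym oner_eq0.
  exists (a 0 0) => //; rewrite [LHS]mx22E.
  congr mx22; [move: e1|move: e3|]; try by move/matrixP/(_ 0 0); rewrite !mxE.
  by rewrite -[RHS]mulr1 -e2 mulKf.
do 2?apply: zclosedI; apply: zclosed_eq; try by
  (apply: entry_polynomial || apply: polynomial_map_const).
by apply: polynomial_mapM; apply: entry_polynomial.
Qed.

End Mx22.

Lemma unip22_irreducible (C : numFieldType) : zirreducible (@unip22 C).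
Proof.
have [[M0 h0] h] : zirreducible (fun M : 'M[C]_2 =>
    exists2 t, (1 : {poly C}).[t] != 0 & M = mx22 1 t 0 1).
  apply: zirreducible_curve; first exact: oner_neq0.
  move=> i j; exists (if i == 0 then (if j == 0 then 1 else 'X)
                      else (if j == 0 then 0 else 1)) => t _.
  by rewrite mxE; case: eqP => _; case: eqP => _; rewrite !hornerE.
have e M : unip22 M <-> exists2 t, (1 : {poly C}).[t] != 0 & M = mx22 1 t 0 1.
  by split=> [[t ->]|[t _ ->]]; exists t => //; rewrite hornerE oner_neq0.
split; first by exists M0; apply/e.
move=> Z1 Z2 c1 c2 cov; have [|H|H] := h _ _ c1 c2.
- by move=> M /e; apply: cov.
- by left=> M /e; apply: H.
by right=> M /e; apply: H.
Qed.

Lemma torus22_irreducible (C : numFieldType) : zirreducible (@torus22 C).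
Proof.
have [[M0 h0] h] : zirreducible (fun M : 'M[C]_2 =>
    exists2 t, ('X : {poly C}).[t] != 0 & M = mx22 t 0 0 t^-1).
  apply: zirreducible_curve; first by rewrite polyX_eq0.
  (* Multiplication by the denominator X turns the entries t and t^-1 into X^2 and 1. *)
  move=> i j; exists (if i == 0 then (if j == 0 then 'X ^+ 2 else 0)
                      else (if j == 0 then 0 else 1)) => t.
  rewrite mxE hornerX => t0.
  by case: eqP => _; case: eqP => _; rewrite !hornerE ?mulfV.
have e M : torus22 M <-> exists2 t, ('X : {poly C}).[t] != 0 & M = mx22 t 0 0 t^-1.
  by split=> [[t t0 ->]|[t]]; rewrite ?hornerX => *; exists t; rewrite ?hornerX.
split; first by exists M0; apply/e.
move=> Z1 Z2 c1 c2 cov; have [|H|H] := h _ _ c1 c2.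
- by move=> M /e; apply: cov.
- by left=> M /e; apply: H.
by right=> M /e; apply: H.
Qed.

(** * Bases adapted to a tensor product *)

Section Interleave.
Variable C : fieldType.

(* The rows of P 0, ..., P (q - 1) in the order of the basis of a tensor
   product: row i of P j has index (i, j). *)
Definition interleave (m q n : nat) (P : 'I_q -> 'M[C]_(m, n)) : 'M[C]_(m * q, n) :=
  \matrix_r row (mxtens_unindex r).1 (P (mxtens_unindex r).2).

Lemma row_interleave m q n (P : 'I_q -> 'M[C]_(m, n)) i j :
  row (mxtens_index (i, j)) (interleave P) = row i (P j).
Proof. by rewrite rowK mxtens_indexK. Qed.

Lemma interleave_mul m q n p (P : 'I_q -> 'M[C]_(m, n)) (M : 'M[C]_(n, p)) :
  interleave P *m M = interleave (fun j => P j *m M).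
Proof. by apply/row_matrixP => r; rewrite row_mul !rowK row_mul. Qed.

Lemma eq_interleave m q n (P Q : 'I_q -> 'M[C]_(m, n)) :
  (forall j, P j = Q j) -> interleave P = interleave Q.
Proof. by move=> e; apply/row_matrixP => r; rewrite !rowK e. Qed.

Lemma lift01 : lift ord0 ord0 = 1 :> 'I_2.
Proof. exact: val_inj. Qed.

Lemma tens1_interleave m n (a : 'M[C]_2) (P : 'I_2 -> 'M[C]_(m, n)) :
  ((1%:M : 'M_m) *t a) *m interleave P =
  interleave (fun j => a j 0 *: P 0 + a j 1 *: P 1).
Proof.
apply/row_matrixP => r; case: (mxtens_indexP r) => i j.
rewrite row_interleave linearD !linearZ /= row_mul.
apply/rowP => c; rewrite !mxE.
rewrite (reindex (@mxtens_index m 2)) /=; last first.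
  by exists (@mxtens_unindex m 2) => x _; rewrite ?mxtens_indexK ?mxtens_unindexK.
rewrite (eq_bigr (fun p => (i == p.1)%:R * a j p.2 * P p.2 p.1 c)); last first.
  by case=> i' j' _; rewrite [row _ _ _ _]mxE tensmxE [1%:M _ _]mxE [interleave _ _ _]mxE mxE mxtens_indexK.
rewrite -(pair_bigA _ (fun i' j' => (i == i')%:R * a j j' * P j' i' c)) /=.
rewrite (bigD1 i) //= [X in _ + X]big1 ?addr0 => [|i' ii].
  by rewrite !big_ord_recl big_ord0 addr0 eqxx !mul1r lift01.
by rewrite big1 // => j' _; rewrite eq_sym (negPf ii) !mul0r.
Qed.

Lemma interleave_sub m q n (P : 'I_q -> 'M[C]_(m, n)) j :
  (P j <= interleave P)%MS.
Proof.
by apply/row_subP => i; rewrite -(row_interleave P); apply: row_sub.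
Qed.

Lemma interleave_unit m (P : 'I_2 -> 'M[C]_(m, m * 2)) :
  (1%:M <= P 0 + P 1)%MS -> interleave P \in unitmx.
Proof.
move=> h; rewrite -row_full_unit -sub1mx; apply: submx_trans h _.
by rewrite addsmx_sub !interleave_sub.
Qed.

Lemma interleave_form m q n (P : 'I_q -> 'M[C]_(m, n)) (M N : 'M[C]_n) :
  row_full (interleave P) ->
  (forall i j, P i *m M *m (P j)^T = P i *m N *m (P j)^T) -> M = N.
Proof.
move=> full h; set B := interleave P in full.
have eB : B *m M *m B^T = B *m N *m B^T.
  have -> : B *m M = interleave (fun j => P j *m M) by exact: interleave_mul.
  have -> : B *m N = interleave (fun j => P j *m N) by exact: interleave_mul.
  apply/matrixP => r s.
  have e (Q : 'I_q -> 'M[C]_(m, n)) :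
    (interleave Q *m B^T) r s =
    (Q (mxtens_unindex r).2 *m (P (mxtens_unindex s).2)^T)
       (mxtens_unindex r).1 (mxtens_unindex s).1.
    by rewrite !mxE; apply: eq_bigr => c _; rewrite !mxE.
  by rewrite !e h.
apply/(row_full_inj full)/trmx_inj/(row_full_inj full)/trmx_inj.
by rewrite !(trmx_mul, trmxK).
Qed.

End Interleave.

Lemma monad_map_mulmx (C : fieldType) (k m : nat)
    (A : 'I_4 -> 'M[C]_(k, k.+1 * 2)) (v : 'rV[C]_m) (M : 'M[C]_(m, 4)) :
  monad_map A (v *m M) = \sum_r v 0 r *: monad_map A (row r M).
Proof.
rewrite /monad_map; under [RHS]eq_bigr do rewrite scaler_sumr.
rewrite exchange_big; apply: eq_bigr => i _; rewrite mxE scaler_suml.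
by apply: eq_bigr => r _; rewrite scalerA mxE.
Qed.

(** Fine actions in adapted bases: [L] lists points of two skew lines, [P] a basis of W. Points are
    rows on which g acts from the right, while W is acted on by the transpose of [Gam]; hence [tau]
    is an inverse, [beta] a transpose, and [a] acts on the [P j] through its transpose. *)
Lemma fine_subgroup_basis (C : numClosedFieldType) (k : nat) (E : bundle_data C 2)
    (J : 'M[C]_(k.+1 * 2)) (A : 'I_4 -> 'M[C]_(k, k.+1 * 2))
    (L : 'I_2 -> 'M[C]_(2, 2 * 2)) (P : 'I_2 -> 'M[C]_(k.+1, k.+1 * 2))
    (H : 'M[C]_2 -> Prop) :
  is_bundle E -> represents J A E ->
  (1%:M <= L 0 + L 1)%MS -> (1%:M <= P 0 + P 1)%MS ->
  H 1%:M -> (forall a b, H a -> H b -> H (a *m b)) ->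
  (forall a, H a -> H (invmx a)) -> (forall a, H a -> \det a = 1) ->
  zclosed H -> zirreducible H -> (exists2 a, H a & a != 1%:M) ->
  (forall a, H a -> exists2 Gam : 'M[C]_(k.+1 * 2),
     Gam *m J *m Gam^T = J /\
     (forall j, P j *m Gam = a 0 j *: P 0 + a 1 j *: P 1) &
     forall i j, (a j 0 *: monad_map A (row i (L 0))
                  + a j 1 *: monad_map A (row i (L 1))) *m Gam
                 = monad_map A (row i (L j))) ->
  exists G : 'M[C]_4 -> Prop,
    [/\ closed_subgroup G, forall g, G g -> Sym0 E g, positive_dim G
      & fine_action k E G].
Proof.
move=> bE repA Lfull Pfull H1 HM HV Hdet Hcl Hirr Hnt equi.
pose T := interleave L; pose B := interleave P.
have uT : T \in unitmx by apply: interleave_unit.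
have uB : B \in unitmx by apply: interleave_unit.
apply: (fine_subgroup (tau := invmx T) (beta := B^T) (H := H) bE repA) => //.
- by rewrite unitmx_inv.
- by rewrite unitmx_tr.
move=> a Ha; have [Gam [symG PG] AG] := equi a Ha.
set gW := _ *m invmx B^T.
have gWE : gW^T = Gam.
  rewrite !trmx_mul trmx_inv trmxK mulmxA trmx_tens trmx1 -mulmxA.
  apply: (canLR (mulKmx uB)); rewrite tens1_interleave interleave_mul.
  by apply: eq_interleave => j; rewrite PG !mxE.
split; first by rewrite gWE -[X in _ *m X](trmxK gW) gWE.
move=> l; rewrite invmxK gWE; under eq_bigr do rewrite scalemxAl.
rewrite -mulmx_suml -[X in X *m _ = _]/(\sum_j _).
set g := _ *m T.
have -> : \sum_j g l j *: A j = monad_map A (row l (invmx T) *m ((1%:M *t a) *m T)).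
  by rewrite -row_mul mulmxA; apply: eq_bigr => j _; rewrite [in RHS]mxE.
rewrite monad_map_mulmx mulmx_suml.
transitivity (monad_map A (row l (invmx T) *m T)); last first.
  by rewrite -row_mul mulVmx // row1; exact: monad_map_delta.
rewrite monad_map_mulmx; apply: eq_bigr => r _; rewrite -scalemxAl; congr (_ *: _).
case: (mxtens_indexP r) => i j; rewrite tens1_interleave !row_interleave -AG.
by rewrite linearD !linearZ /= monad_mapD !monad_mapZ.
Qed.

(** * Skew lines and double lines *)

Lemma row_fullP0 (C : fieldType) (m n : nat) (M : 'M[C]_(m, n)) :
  (forall v : 'cV_n, M *m v = 0 -> v = 0) -> row_full M.
Proof.
move=> H; rewrite /row_full -mxrank_tr -/(row_free M^T).
apply: row_freeP0 => v /(congr1 trmx); rewrite trmx_mul trmxK trmx0 => /H.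
by move/(congr1 trmx); rewrite trmxK trmx0.
Qed.

Lemma isotropic_rank (C : fieldType) (m n : nat) (J : 'M[C]_n) (M : 'M[C]_(m, n)) :
  J \in unitmx -> M *m J *m M^T = 0 -> ((\rank M).*2 <= n)%N.
Proof.
move=> uJ; rewrite -mulmxA => /mulmx0_rank_max.
suff -> : \rank (J *m M^T) = \rank M by rewrite addnn.
by rewrite -mxrank_tr trmx_mul trmxK mxrankMfree // row_free_unit unitmx_tr.
Qed.

Lemma submx_isotropic (C : fieldType) (m p n : nat) (J : 'M[C]_n)
    (M : 'M[C]_(m, n)) (N : 'M[C]_(p, n)) :
  (M <= N)%MS -> N *m J *m N^T = 0 -> M *m J *m M^T = 0.
Proof.
move=> /submxP[D ->] h; rewrite trmx_mul !mulmxA -(mulmxA D) -(mulmxA D) h.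
by rewrite mulmx0 mul0mx.
Qed.

Lemma rank_basis (C : fieldType) (m n r : nat) (M : 'M[C]_(m, n)) :
  \rank M = r -> exists P : 'M[C]_(r, n), (P :=: M)%MS.
Proof. by move<-; exists (row_base M); apply: eq_row_base. Qed.

(** A relation U1 R' + U2 R = 0, paired with R, gives U1 R J R'^T = 0 by isotropy and symmetry. Then
    U1 R is orthogonal to R and R', so it is 0 and the assignment of R to R' and 0 to R is well
    defined. The last two equations make every 1 - s N symplectic; they are checked on the spanning
    rows. *)
Lemma lagrangian_nilpotent (C : fieldType) (m n : nat) (J : 'M[C]_n)
    (R R' : 'M[C]_(m, n)) :
  J \in unitmx -> J^T = - J -> row_full (col_mx R' R) ->
  R *m J *m R^T = 0 -> (R *m J *m R'^T)^T = R *m J *m R'^T ->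
  exists N : 'M[C]_n,
    [/\ R' *m N = R, R *m N = 0, N *m J + J *m N^T = 0 & N *m J *m N^T = 0].
Proof.
move=> uJ skewJ full isoR symS.
have R'R : R' *m J *m R^T = - (R *m J *m R'^T).
  by rewrite -symS !trmx_mul trmxK skewJ mulNmx mulmxN opprK mulmxA.
have [N [R'N RN]] : exists N : 'M[C]_n, R' *m N = R /\ R *m N = 0.
  (* The rows of [U] are relations among the rows of R' and R. Once they also annihilate the
     prescribed images, the pseudo-inverse defines N. *)
  pose U := col_mx R' R *m pinvmx (col_mx R' R) - 1%:M.
  have UC : U *m col_mx R' R = 0.
    by rewrite mulmxBl mul1mx -mulmxA mulVpmx // mulmx1 subrr.
  have U1R : lsubmx U *m R = 0.
    move: UC; rewrite -{1}[U]hsubmxK mul_row_col.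
    set U1 := lsubmx U; set U2 := rsubmx U => UC.
    have U1S : U1 *m (R *m J *m R'^T) = 0.
      have /(congr1 (fun M => M *m (J *m R^T))) := UC.
      rewrite mul0mx mulmxDl -!(mulmxA _ _ (J *m R^T)) !(mulmxA _ J) isoR mulmx0.
      by rewrite addr0 R'R mulmxN => /eqP; rewrite oppr_eq0 => /eqP.
    have : U1 *m R *m J *m (col_mx R' R)^T = 0.
      rewrite tr_col_mx mul_mx_row -(mulmxA U1) -!(mulmxA U1) U1S isoR mulmx0.
      exact: row_mx0.
    move/(congr1 trmx); rewrite trmx_mul trmxK trmx0 => h.
    have : (U1 *m R *m J)^T = 0 by apply: (row_full_inj full); rewrite h mulmx0.
    move/(congr1 trmx); rewrite trmxK trmx0 => h'.
    by rewrite -[LHS](mulmxK uJ) h' mul0mx.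
  exists (pinvmx (col_mx R' R) *m col_mx R 0).
  have : U *m col_mx R 0 = 0.
    by rewrite -{1}[U]hsubmxK mul_row_col mulmx0 addr0.
  rewrite mulmxBl mul1mx -mulmxA mul_col_mx => /eqP.
  by rewrite subr_eq0 => /eqP/eq_col_mx[-> ->].
have CD : col_mx R' R *m N = col_mx R 0 by rewrite mul_col_mx R'N RN.
have formP (M : 'M[C]_n) :
    col_mx R' R *m M *m (col_mx R' R)^T = 0 -> M = 0.
  move=> h; apply: (row_full_inj full); rewrite mulmx0; apply: trmx_inj.
  apply: (row_full_inj full); rewrite trmx0 mulmx0; apply: trmx_inj.
  by rewrite trmx_mul trmxK h trmx0.
have NJ : N *m J + J *m N^T = 0.
  apply: formP; rewrite mulmxDr mulmxDl.
  have -> : col_mx R' R *m (J *m N^T) *m (col_mx R' R)^T =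
            col_mx R' R *m J *m (col_mx R 0)^T by rewrite -CD trmx_mul !mulmxA.
  rewrite mulmxA CD !tr_col_mx !(mul_col_mx _ _ J) !mul_col_row.
  rewrite !trmx0 !mul0mx !mulmx0 isoR R'R.
  by rewrite add_block_mx !addr0 addrN block_mx0.
have NJN : N *m J *m N^T = 0.
  apply: formP.
  have -> : col_mx R' R *m (N *m J *m N^T) *m (col_mx R' R)^T =
            col_mx R 0 *m J *m (col_mx R 0)^T by rewrite -CD trmx_mul !mulmxA.
  by rewrite tr_col_mx trmx0 (mul_col_mx _ _ J) mul_col_row isoR !mul0mx !mulmx0 block_mx0.
by exists N.
Qed.

Section Lines.
Variables (C : numClosedFieldType) (k : nat).
Variables (J : 'M[C]_(k.+1 * 2)) (A : 'I_4 -> 'M[C]_(k, k.+1 * 2)).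
Hypothesis monadA : monad J A.
Hypothesis spanA : forall w : 'cV_(k.+1 * 2), (forall i, A i *m w = 0) -> w = 0.

Definition line_mx (L : 'M[C]_(2, 2 * 2)) : 'M[C]_(k + k, k.+1 * 2) :=
  col_mx (monad_map A (row 0 L)) (monad_map A (row 1 L)).

Lemma line_mx_isotropic L :
  jump_mx J A (row 0 L) (row 1 L) = 0 -> line_mx L *m J *m (line_mx L)^T = 0.
Proof.
move=> h; rewrite /line_mx tr_col_mx mul_col_mx mul_col_row.
rewrite -!/(jump_mx J A _ _) !(jump_mxx monadA) h (jump_mxC monadA) h oppr0.
exact: block_mx0.
Qed.

Lemma line_mx_rank_le L :
  jump_mx J A (row 0 L) (row 1 L) = 0 -> (\rank (line_mx L) <= k.+1)%N.
Proof.
move/line_mx_isotropic/(isotropic_rank (monad_nondeg monadA)).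
by rewrite [X in (_ <= X)%N -> _]muln2 leq_double.
Qed.

Lemma monad_map_line i L : (monad_map A (row i L) <= line_mx L)%MS.
Proof.
by elim/ord2P: i; rewrite /line_mx -addsmxE ?addsmxSl ?addsmxSr.
Qed.

Lemma lines_span (L : 'I_2 -> 'M[C]_(2, 2 * 2)) (n : nat) (M : 'M[C]_(_, n)) :
  (1%:M <= L 0 + L 1)%MS -> line_mx (L 0) *m M = 0 -> line_mx (L 1) *m M = 0 ->
  M = 0.
Proof.
move=> Lfull h0 h1.
have hM : forall j, line_mx (L j) *m M = 0 by elim/ord2P.
have rowM j i : monad_map A (row i (L j)) *m M = 0.
  have /submxP[D ->] := monad_map_line i (L j).
  by rewrite -mulmxA hM mulmx0.
apply: mulmx_cV_inj => v; rewrite mul0mx; apply: spanA => i.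
have : ((delta_mx 0 i : 'rV[C]_(2 * 2)) <= L 0 + L 1)%MS.
  exact: submx_trans (submx1 _) Lfull.
move=> /sub_addsmxP[[u u'] /= e].
rewrite -monad_map_delta [delta_mx 0 i]e monad_mapD !monad_map_mulmx mulmxDl !mulmx_suml.
by rewrite !big1 ?addr0 // => r _; rewrite -scalemxAl mulmxA rowM mul0mx scaler0.
Qed.

(** The points of a line give a free pencil. With the isotropic bound [line_mx_rank_le], the rank on
    a line of order k is exactly k + 1. *)
Lemma line_mx_rank_gt (L : 'M[C]_(2, 2 * 2)) :
  (0 < k)%N -> row_free L -> (k < \rank (line_mx L))%N.
Proof.
move=> k0 freeL; rewrite /line_mx -addsmxE; apply: free_pencil_rank => //.
apply: (monad_free_pencil monadA) => a b; apply: contraNneq => e.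
pose u : 'rV[C]_2 := \row_i (if i == 0 then a else b).
have : u = 0.
  apply: (row_free_inj freeL); rewrite mul0mx mulmx_sum_row.
  by rewrite !big_ord_recl big_ord0 addr0 lift01 !mxE.
move/rowP => e'; have := e' 0; have := e' 1; rewrite !mxE /= => -> ->.
by rewrite eqxx.
Qed.

Section LineBundleAction.
Variable E : bundle_data C 2.
Hypothesis bundleE : is_bundle E.
Hypothesis repA : represents J A E.
Variable L : 'I_2 -> 'M[C]_(2, 2 * 2).
Hypothesis Lfull : (1%:M <= L 0 + L 1)%MS.

Let conclusion := exists G : 'M[C]_4 -> Prop,
  [/\ closed_subgroup G, forall g, G g -> Sym0 E g, positive_dim G
    & fine_action k E G].

Lemma skew_lines_fine_action :
  (forall j, jump_mx J A (row 0 (L j)) (row 1 (L j)) = 0) -> conclusion.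
Proof.
move=> jumpL.
have full : (1%:M <= line_mx (L 1) + line_mx (L 0))%MS.
  rewrite sub1mx /row_full addsmxE -[_ == _]/(row_full _); apply: row_fullP0 => v.
  rewrite mul_col_mx => /eqP; rewrite col_mx_eq0 => /andP[/eqP v1 /eqP v0].
  exact: (lines_span Lfull).
have rk : forall j, \rank (line_mx (L j)) = k.+1.
  have le j := line_mx_rank_le (jumpL j).
  have := leq_trans (mxrankS full) (mxrank_adds_leqif _ _).
  rewrite mxrank1 => sum.
  have : (k.+1 * 2 = k.+1 + k.+1)%N by rewrite muln2 addnn.
  by move=> e; elim/ord2P; apply/eqP; rewrite eqn_leq le /=;
     move: sum (le 0) (le 1); lia.
(* The order is reversed on purpose: [Gam] must cancel the weight t of the line [L 0], and it acts
   by t^-1 on [P 1]. *)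
have [P0 eP0] := rank_basis (rk 1); have [P1 eP1] := rank_basis (rk 0).
pose P (j : 'I_2) := if j == 0 then P0 else P1.
have Pfull : (1%:M <= P 0 + P 1)%MS.
  by apply: submx_trans full _; rewrite addsmxS ?eP0 ?eP1.
have iso0 : P0 *m J *m P0^T = 0.
  by apply: (submx_isotropic _ (line_mx_isotropic (jumpL 1))); rewrite eP0.
have iso1 : P1 *m J *m P1^T = 0.
  by apply: (submx_isotropic _ (line_mx_isotropic (jumpL 0))); rewrite eP1.
have uB := interleave_unit Pfull.
apply: (fine_subgroup_basis (H := @torus22 C) bundleE repA Lfull Pfull).
- exact: torus22_1.
- exact: torus22_mul.
- exact: torus22_inv.
- exact: torus22_det.
- exact: torus22_closed.
- exact: torus22_irreducible.
- exists (mx22 2 0 0 2^-1); first by exists 2; rewrite // pnatr_eq0.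
  apply/eqP => /matrixP/(_ 0 0); rewrite !mxE /= => /eqP.
  by rewrite (eqr_nat _ 2 1).
move=> _ [t t0 ->].
have [Gam PG] : exists Gam : 'M[C]_(k.+1 * 2),
    forall j, P j *m Gam = (if j == 0 then t else t^-1) *: P j.
  pose Q j := (if j == 0 then t else t^-1) *: P j.
  exists (invmx (interleave P) *m interleave Q) => j.
  apply/row_matrixP => i.
  rewrite -(row_interleave (fun j => P j *m _)) -interleave_mul mulKVmx //.
  by rewrite row_interleave.
exists Gam; first split.
- apply: (interleave_form (P := P)); first by rewrite row_full_unit.
  move=> i j.
  have -> : P i *m (Gam *m J *m Gam^T) *m (P j)^T = (P i *m Gam) *m J *m (P j *m Gam)^T.
    by rewrite trmx_mul !mulmxA.
  rewrite !PG [(_ *: _)^T]linearZ /= -scalemxAr -!scalemxAl scalerA.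
  elim/ord2P: i; elim/ord2P: j => /=; rewrite ?iso0 ?iso1 ?scaler0 //.
    by rewrite mulVf // scale1r.
  by rewrite mulfV // scale1r.
- by move=> j; rewrite PG; elim/ord2P: j; rewrite !mxE /= scale0r ?addr0 ?add0r.
move=> i; elim/ord2P; rewrite !mxE /= scale0r ?addr0 ?add0r.
  have /submxP[D ->] : (monad_map A (row i (L 0)) <= P1)%MS.
    by rewrite eP1 monad_map_line.
  by rewrite -scalemxAl -mulmxA (PG 1) /= -scalemxAr scalerA mulfV // scale1r.
have /submxP[D ->] : (monad_map A (row i (L 1)) <= P0)%MS.
  by rewrite eP0 monad_map_line.
by rewrite -scalemxAl -mulmxA (PG 0) /= -scalemxAr scalerA mulVf // scale1r.
Qed.

Lemma double_line_fine_action :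
  (0 < k)%N -> jump_mx J A (row 0 (L 1)) (row 1 (L 1)) = 0 ->
  jump_mx J A (row 0 (L 1)) (row 1 (L 0)) +
    jump_mx J A (row 0 (L 0)) (row 1 (L 1)) = 0 -> conclusion.
Proof.
move=> k0 jump1 jump01.
have uJ := monad_nondeg monadA.
pose R := line_mx (L 1); pose R' := line_mx (L 0).
have isoR : R *m J *m R^T = 0 by apply: line_mx_isotropic.
(* The four blocks are symmetric by [trmx_jump_mx]; equality of the two off-diagonal ones is the
   tangency condition [jump01]. *)
have symS : (R *m J *m R'^T)^T = R *m J *m R'^T.
  rewrite /R /R' /line_mx tr_col_mx mul_col_mx mul_col_row.
  rewrite -!/(jump_mx J A _ _) tr_block_mx !(trmx_jump_mx monadA).
  suff -> : jump_mx J A (row 0 (L 1)) (row 1 (L 0)) =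
            jump_mx J A (row 1 (L 1)) (row 0 (L 0)) by [].
  by apply/eqP; rewrite (jump_mxC monadA (row 0 (L 0))) -addr_eq0 jump01.
have full : row_full (col_mx R' R).
  apply: row_fullP0 => v.
  rewrite mul_col_mx => /eqP; rewrite col_mx_eq0 => /andP[/eqP v0 /eqP v1].
  exact: (lines_span Lfull).
have [N [R'N RN NJ NJN]] := lagrangian_nilpotent uJ (monad_skew monadA) full isoR symS.
have rkR : \rank R = k.+1.
  apply/eqP; rewrite eqn_leq line_mx_rank_le //= line_mx_rank_gt //.
  have := leq_trans (mxrankS Lfull) (mxrank_adds_leqif _ _).
  rewrite mxrank1 /row_free => sum; rewrite eqn_leq rank_leq_row /=.
  by move: sum (rank_leq_row (L 0)); lia.
have [P0 eP0] := rank_basis rkR.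
have /submxP[Q P0E] : (P0 <= R)%MS by rewrite eP0.
have P0N : P0 *m N = 0 by rewrite P0E -mulmxA RN mulmx0.
(* N sends Q R' to Q R = P0. The sign is chosen so that 1 - s N adds s P0 to [P 1], while it undoes
   the shear of R' to R' + s R. *)
pose P (j : 'I_2) := if j == 0 then P0 else - (Q *m R').
have P1N : P 1 *m N = - P0 by rewrite mulNmx -mulmxA R'N -P0E.
have freeP0 : row_free P0 by rewrite /row_free eP0 rkR.
have freeP1 : row_free (P 1).
  apply: row_freeP0 => v vP; apply: (row_free_inj freeP0); rewrite mul0mx.
  by apply/eqP; rewrite -oppr_eq0 -mulmxN -P1N mulmxA vP mul0mx.
have Pfull : (1%:M <= P 0 + P 1)%MS.
  rewrite sub1mx /row_full mxrank_disjoint_sum ?(eqP freeP0) ?(eqP freeP1).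
    by rewrite addnn muln2.
  apply/eqP/rowV0P => v; rewrite sub_capmx => /andP[/submxP[c0 e0] /submxP[c1 e1]].
  have : c1 = 0.
    apply: (row_free_inj freeP0); apply/eqP; rewrite mul0mx -oppr_eq0 -mulmxN -P1N.
    by rewrite mulmxA -e1 e0 -mulmxA P0N mulmx0.
  by rewrite e1 => ->; rewrite mul0mx.
apply: (fine_subgroup_basis (H := @unip22 C) bundleE repA Lfull Pfull).
- exact: unip22_1.
- exact: unip22_mul.
- exact: unip22_inv.
- exact: unip22_det.
- exact: unip22_closed.
- exact: unip22_irreducible.
- exists (mx22 1 1 0 1); first by exists 1.
  apply/eqP => /matrixP/(_ 0 1); rewrite !mxE /= => /eqP.
  by rewrite oner_eq0.
move=> _ [s ->]; exists (1%:M - s *: N).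
  split; last first.
    elim/ord2P; rewrite !mxE /= mulmxBr mulmx1 -scalemxAr.
      by rewrite P0N scaler0 subr0 scale1r scale0r addr0.
    by rewrite P1N scalerN opprK scale1r addrC.
  rewrite [(_ - _)^T]linearB /= trmx1 [(s *: N)^T]linearZ /=.
  have -> : (1%:M - s *: N) *m J *m (1%:M - s *: N^T) =
      J - s *: (N *m J + J *m N^T) + s *: (s *: (N *m J *m N^T)).
    rewrite mulmxBr mulmx1 !mulmxBl mul1mx -!scalemxAl -!scalemxAr.
    by rewrite scalerDr !opprD opprK !addrA [_ - _ - _ + _]addrAC.
  by rewrite NJ NJN !scaler0 subr0 addr0.
have R'Ni i : monad_map A (row i (L 0)) *m N = monad_map A (row i (L 1)).
  by move: R'N; rewrite mul_col_mx => /eq_col_mx[]; elim/ord2P: i.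
have RNi i : monad_map A (row i (L 1)) *m N = 0.
  have /submxP[D ->] := monad_map_line i (L 1).
  by rewrite -mulmxA RN mulmx0.
move=> i; elim/ord2P; rewrite !mxE /= mulmxBr mulmx1 -scalemxAr mulmxDl
  -!scalemxAl R'Ni RNi ?scaler0 ?addr0 ?scale1r ?scale0r ?add0r ?scaler0 ?subr0 //.
by rewrite addrK.
Qed.

End LineBundleAction.

End Lines.

(** * Planes of matrices of size m x (m + 1) *)

(* The Krylov matrix of the controllability test of Kalman: it is singular iff
   some left eigenvector of M is orthogonal to w. *)
Definition krylov (R : comNzRingType) (m : nat) (M : 'M[R]_m) (w : 'cV[R]_m) : 'M[R]_m :=
  \matrix_(i, j) iter j (mulmx M) w i 0.

Lemma map_krylov (R S : comNzRingType) (f : {rmorphism R -> S}) (m : nat)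
    (M : 'M[R]_m) (w : 'cV[R]_m) :
  map_mx f (krylov M w) = krylov (map_mx f M) (map_mx f w).
Proof.
apply/matrixP => i j; rewrite !mxE.
have <- : map_mx f (iter j (mulmx M) w) = iter j (mulmx (map_mx f M)) (map_mx f w).
  by elim: (nat_of_ord j) => //= l <-; rewrite map_mxM.
by rewrite mxE.
Qed.

(** The determinant is homogeneous in (M, w) of degree 1 + ... + m = m (m + 1) / 2, the expected
    number of points of a plane where an m x (m + 1) matrix of linear forms drops rank. *)
Lemma det_krylovZ (R : comNzRingType) (m : nat) (M : 'M[R]_m) (w : 'cV[R]_m) a :
  \det (krylov (a *: M) (a *: w)) = \det (krylov M w) * \prod_(j < m) a ^+ j.+1.
Proof.
have -> : krylov (a *: M) (a *: w) = krylov M w *m diag_mx (\row_j a ^+ j.+1).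
  apply/matrixP => i j; rewrite mul_mx_diag !mxE.
  have -> : iter j (mulmx (a *: M)) (a *: w) = a ^+ j.+1 *: iter j (mulmx M) w.
    elim: (nat_of_ord j) => [|l IH] /=; first by rewrite expr1.
    by rewrite IH -scalemxAl -scalemxAr scalerA -exprS.
  by rewrite mxE mulrC.
by rewrite det_mulmx det_diag; congr (_ * _); apply: eq_bigr => j _; rewrite mxE.
Qed.

Lemma mulmx_krylov (R : comNzRingType) (p m : nat) (K : 'M[R]_(p, m))
    (M : 'M[R]_m) (w : 'cV[R]_m) i j :
  (K *m krylov M w) i j = (K *m iter j (mulmx M) w) i 0.
Proof.
by rewrite [LHS]mxE [RHS]mxE; apply: eq_bigr => l _; rewrite [krylov _ _ _ _]mxE.
Qed.

Lemma rank_le1 (C : fieldType) (m n : nat) (M : 'M[C]_(m, n)) :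
  (\rank M <= 1)%N -> exists g : 'rV_n, (M <= g)%MS.
Proof.
have [->|M0] := eqVneq M 0; first by exists 0; apply: sub0mx.
move=> rk; exists (nz_row M).
rewrite -(mxrank_leqif_sup (nz_row_sub M)) eqn_leq mxrankS ?nz_row_sub //=.
by rewrite (leq_trans rk) // lt0n mxrank_eq0 nz_row_eq0.
Qed.

Section Planes.
Variable C : numClosedFieldType.

(** By Cayley-Hamilton the left kernel of the Krylov matrix kills p(M) w for every polynomial p; it
    is therefore stable under M and contains an eigenvector. *)
Lemma krylov_eigenvector (m : nat) (M : 'M[C]_m) (w : 'cV[C]_m) :
  \det (krylov M w) = 0 ->
  exists2 v : 'rV_m, v != 0 & exists2 a, v *m M = a *: v & v *m w = 0.
Proof.
case: m M w => [M w|m M w]; first by rewrite det_mx00 => /eqP; rewrite oner_eq0.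
move=> /eqP/det0P[v0 v0n v0K].
pose K := kermx (krylov M w).
have K0 : K != 0.
  by apply: contraNneq v0n => eK; rewrite -submx0 -eK; apply/sub_kermxP.
have iterE j : iter j (mulmx M) w = M ^+ j *m w.
  by elim: j => [|j IH] /=; rewrite ?mul1mx // IH mulmxA exprS.
have Kj j : (j < m.+1)%N -> K *m (M ^+ j *m w) = 0.
  move=> jm; rewrite -iterE; apply/colP => i.
  by rewrite -(mulmx_krylov _ _ _ _ (Ordinal jm)) mulmx_ker !mxE.
have Kp (p : {poly C}) : K *m horner_mx M p *m w = 0.
  rewrite (divp_eq p (char_poly M)) rmorphD rmorphM /= Cayley_Hamilton mulr0 add0r.
  set r := p %% _.
  have sr : (size r <= m.+1)%N.
    by rewrite -ltnS -(size_char_poly M) ltn_modp -size_poly_eq0 size_char_poly.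
  rewrite -mulmxA -[r]coefK poly_def rmorph_sum mulmx_suml mulmx_sumr big1 // => i _.
  rewrite -mul_polyC rmorphM rmorphXn /= horner_mx_X horner_mx_C.
  rewrite -[_ * _]/(_ *m _) mul_scalar_mx -scalemxAl -scalemxAr Kj ?scaler0 //.
  exact: leq_trans sr.
have [||v [vn /submxP[D vD] [a ha]]] := @pencil_eigenvector _ _ _ _ K M 1%:M K0.
- rewrite mulmx1; apply/sub_kermxP/matrixP => i j.
  rewrite mulmx_krylov iterE -mulmxA (mulmxA M) -[M *m _]/(M * _) -exprS.
  have := Kp ('X ^+ j.+1); rewrite rmorphXn /= horner_mx_X -mulmxA => ->.
  by rewrite !mxE.
- by rewrite row_free_unit unitmx1.
exists v => //; exists a; first by rewrite ha mulmx1.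
by rewrite vD -mulmxA -[w]mul1mx -[1%:M]/(M ^+ 0) Kj // mulmx0.
Qed.

(** The determinant is a binary form of positive degree in (b, c), so it has a zero. If its
    dehomogenization at b = 1 has no root, it is a constant [e]; the form is then [e] times a power
    of b and vanishes at (0, 1). *)
Lemma krylov_pencil_singular (m : nat) (Y Z : 'M[C]_m) (u v : 'cV[C]_m) :
  (0 < m)%N -> exists b c, (b, c) != (0, 0) /\
    \det (krylov (b *: Y + c *: Z) (b *: u + c *: v)) = 0.
Proof.
move=> m0.
have pol (M N : 'M[C]_m) (p q : 'cV[C]_m) : exists d : {poly C}, forall t,
    d.[t] = \det (krylov (M + t *: N) (p + t *: q)).
  exists (\det (krylov (map_mx polyC M + 'X *: map_mx polyC N)
                       (map_mx polyC p + 'X *: map_mx polyC q))) => t.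
  rewrite -[LHS]/(horner_eval t _) -det_map_mx map_krylov; congr (\det (krylov _ _)).
    by apply/matrixP => i j; rewrite !mxE /= /horner_eval !hornerE.
  by apply/matrixP => i j; rewrite !mxE /= /horner_eval !hornerE.
have [d hd] := pol Y Z u v; have [d' hd'] := pol Z Y v u.
have [/closed_rootP[c /rootP rc]|] := boolP (size d != 1%N).
  exists 1, c; rewrite !scale1r -hd rc; split=> //.
  by rewrite xpair_eqE oner_eq0.
rewrite negbK => /size_poly1P[e e0 dE].
exists 0, 1; split; first by rewrite xpair_eqE oner_eq0 andbF.
rewrite !scale0r !scale1r !add0r -[Z]addr0 -[v]addr0 -(scale0r Y) -(scale0r u) -hd'.
(* Homogeneity relates the two dehomogenizations at every t != 0, so the difference [q] is the zero
   polynomial; evaluation at 0 is then allowed. *)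
pose q := d' - e%:P * \prod_(j < m) 'X ^+ j.+1.
have q0 : q = 0.
  apply/eqP; apply: contraT => q0.
  have X0 : 'X != 0 :> {poly C} by rewrite polyX_eq0.
  have [t] := poly_nonroot (mulf_neq0 q0 X0).
  rewrite hornerM hornerX mulf_eq0 negb_or => /andP[+ t0].
  rewrite /q hornerD hornerN hornerM hornerC horner_prod hd'.
  have -> : Z + t *: Y = t *: (Y + t^-1 *: Z).
    by rewrite scalerDr scalerA mulfV // scale1r addrC.
  have -> : v + t *: u = t *: (u + t^-1 *: v).
    by rewrite scalerDr scalerA mulfV // scale1r addrC.
  rewrite det_krylovZ -hd dE hornerC.
  by under [X in _ - _ * X]eq_bigr do rewrite hornerXn; rewrite subrr eqxx.
have /(congr1 (fun p => p.[0])) := q0.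
rewrite /q hornerD hornerN hornerM hornerC horner_prod horner0.
rewrite (bigD1 (Ordinal m0)) //= expr1 hornerX mul0r mulr0 subr0 //.
Qed.

(** If X is injective, the sum of the row spaces is spanned by X and one more row [g]. Writing Y =
    Y' X + u g and Z = Z' X + v g, a left eigenvector of b Y' + c Z' orthogonal to b u + c v is
    killed by the corresponding combination. *)
Lemma matrix_plane_singular (m n : nat) (X Y Z : 'M[C]_(m, n)) :
  (0 < m)%N -> (\rank (X + Y + Z)%MS <= m.+1)%N ->
  exists a b c, (a, b, c) != (0, 0, 0) /\
    exists2 x : 'rV_m, x != 0 & x *m (a *: X + b *: Y + c *: Z) = 0.
Proof.
move=> m0 rk; have [freeX|nfree] := boolP (row_free X); last first.
  exists 1, 0, 0; split; first by rewrite !xpair_eqE oner_eq0.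
  move: nfree; rewrite -kermx_eq0 => /rowV0Pn[x /sub_kermxP xX x0].
  by exists x => //; rewrite !scale0r !addr0 scale1r.
pose S := (X + Y + Z)%MS.
have XS : (X <= S)%MS by rewrite /S -addsmxA addsmxSl.
have [g hg] : exists g : 'rV_n, (S :\: X <= g)%MS.
  apply: rank_le1; have := mxrank_cap_compl S X.
  have -> : \rank (S :&: X)%MS = m.
    by rewrite (capmx_idPr XS) (eqP freeX).
  by move: rk; rewrite -/S; lia.
have SXg : (S <= X + g)%MS.
  rewrite -(addsmx_diff_cap_eq S X) addsmx_sub (submx_trans hg) ?addsmxSr //=.
  by apply: submx_trans (capmxSr _ _) (addsmxSl _ _).
have /sub_addsmxP[[Y' u] /= eY] : (Y <= X + g)%MS.
  by apply: submx_trans SXg; rewrite /S addsmxC addsmxA addsmxSr.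
have /sub_addsmxP[[Z' v] /= eZ] : (Z <= X + g)%MS.
  by apply: submx_trans SXg; rewrite /S addsmxSr.
have [b [c [bc /krylov_eigenvector[x x0 [a xa xw]]]]] :=
  krylov_pencil_singular Y' Z' u v m0.
exists (- a), b, c; split.
  by apply: contraNneq bc => -[_ -> ->].
exists x => //.
have -> : - a *: X + b *: Y + c *: Z =
   (b *: Y' + c *: Z' - a%:M) *m X + (b *: u + c *: v) *m g.
  rewrite eY eZ mulmxBl mul_scalar_mx !mulmxDl -!scalemxAl !scalerDr scaleNr.
  by rewrite -addrA [X in _ + X]addrACA addrA [in LHS](addrC (- _)).
rewrite mulmxDr !mulmxA xw mul0mx addr0 mulmxBr xa mul_mx_scalar subrr.
by rewrite mul0mx.
Qed.

End Planes.

(** Among the values X, Y, Z of A at u, v, w only Y and Z can pair nontrivially, and their pairing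
    has rank at most 1. If X, Y, Z span at most k + 1 dimensions, [matrix_plane_singular] applies
    directly. Otherwise it applies after restriction to the left kernel of that pairing, which has r
    >= k - 1 independent rows, and r > 0 because k > 1. *)
Lemma meeting_lines_absurd (C : numClosedFieldType) (k : nat)
    (J : 'M[C]_(k.+1 * 2)) (A : 'I_4 -> 'M[C]_(k, k.+1 * 2)) (u v w : 'rV[C]_4) :
  (1 < k)%N -> monad J A ->
  (forall a b c, (a, b, c) != (0, 0, 0) -> a *: u + b *: v + c *: w != 0) ->
  jump_mx J A u v = 0 -> jump_mx J A u w = 0 -> False.
Proof.
move=> k1 monadA indep uv uw; have uJ := monad_nondeg monadA.
set X := monad_map A u; set Y := monad_map A v; set Z := monad_map A w.
pose L := col_mx X (col_mx Y Z).
have sumL : (X + Y + Z :=: L)%MS.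
  rewrite -addsmxA.
  exact: eqmx_trans (adds_eqmx (eqmx_refl X) (addsmxE Y Z)) (addsmxE X _).
have plane (r : nat) (N : 'M[C]_(r, k)) : (0 < r)%N -> row_free N ->
    (\rank (N *m X + N *m Y + N *m Z)%MS <= r.+1)%N -> False.
  move=> r0 freeN /(matrix_plane_singular r0) [a [b [c [abc [x x0 xN]]]]].
  have free := monad_free monadA (indep _ _ _ abc).
  case/negP: x0; apply/eqP.
  apply: (row_free_inj freeN); apply: (row_free_inj free); rewrite !mul0mx -mulmxA.
  rewrite !monad_mapD !monad_mapZ !mulmxDr -!scalemxAr.
  by move: xN; rewrite !mulmxDr -!scalemxAr.
(* The span of X and Y is isotropic, of dimension at most k + 1, and pairing with Z kills its
   k-dimensional subspace X. *)
have rkS : (\rank (jump_mx J A v w) <= 1)%N.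
  pose F := J *m Z^T.
  have rkX : \rank X = k.
    apply: (monad_surj monadA); have := indep 1 0 0.
    by rewrite scale1r !scale0r !addr0; apply; rewrite !xpair_eqE oner_eq0.
  have iso : (\rank (X + Y)%MS <= k.+1)%N.
    have : col_mx X Y *m J *m (col_mx X Y)^T = 0.
      rewrite tr_col_mx mul_col_mx mul_col_row -!/(jump_mx J A _ _).
      by rewrite !(jump_mxx monadA) uv (jump_mxC monadA) uv oppr0 block_mx0.
    move/(isotropic_rank uJ); rewrite addsmxE [X in (_ <= X)%N -> _]muln2.
    by rewrite leq_double.
  have := mxrank_mul_ker (X + Y)%MS F.
  have : (k <= \rank ((X + Y) :&: kermx F)%MS)%N.
    rewrite -[X in (X <= _)%N]rkX mxrankS // sub_capmx addsmxSl; apply/sub_kermxP.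
    by rewrite mulmxA.
  have : (\rank (jump_mx J A v w) <= \rank ((X + Y)%MS *m F))%N.
    by rewrite /jump_mx -mulmxA mxrankS // submxMr // addsmxSr.
  by move: iso; lia.
have [rkL|rkL] := leqP (\rank L) k.+1.
  apply: (plane k 1%:M); rewrite ?row_free_unit ?unitmx1 //; first exact: ltnW.
  by rewrite !mul1mx sumL.
have [r [N [rkN freeN NS]]] : exists r (N : 'M_(r, k)),
    [/\ (k <= r.+1)%N, row_free N & N *m jump_mx J A v w = 0].
  exists (\rank (kermx (jump_mx J A v w))), (row_base (kermx (jump_mx J A v w))).
  split; last by apply/sub_kermxP; rewrite eq_row_base.
    by rewrite mxrank_ker; move: rkS; lia.
  exact: row_base_free.
apply: (plane _ N) => //; first by move: rkN k1; lia.
(* The orthogonal of the span of X, Y, Z has dimension 2k + 2 - rank L <= k <= r + 1, and it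
   contains N X, N Y and N Z. *)
pose P := kermx (J *m L^T).
have rkP : (\rank P <= k)%N.
  rewrite mxrank_ker.
  have -> : \rank (J *m L^T) = \rank L.
    by rewrite -mxrank_tr trmx_mul trmxK mxrankMfree // row_free_unit unitmx_tr.
  by move: rkL; lia.
apply: leq_trans rkN; apply: leq_trans rkP; apply: mxrankS.
have inP (y : 'rV_4) : N *m jump_mx J A y u = 0 -> N *m jump_mx J A y v = 0 ->
    N *m jump_mx J A y w = 0 -> (N *m monad_map A y <= P)%MS.
  have e y' : N *m monad_map A y *m (J *m (monad_map A y')^T) = N *m jump_mx J A y y'.
    by rewrite /jump_mx !mulmxA.
  move=> h1 h2 h3; apply/sub_kermxP; rewrite /L !tr_col_mx !mul_mx_row.
  by rewrite !e h1 h2 h3 !row_mx0.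
rewrite !addsmx_sub -andbA; apply/and3P; split; apply: inP;
  rewrite ?(jump_mxx monadA) ?uv ?uw ?mulmx0 ?NS //.
- by rewrite (jump_mxC monadA) uv oppr0 mulmx0.
- by rewrite (jump_mxC monadA) uw oppr0 mulmx0.
by rewrite (jump_mxC monadA) mulmxN NS oppr0.
Qed.

(** * Pluecker coordinates *)

Section Pluecker.
Variable C : fieldType.
Implicit Types (p q : 'rV[C]_6) (x y : 'rV[C]_4).

(** Natural indices let identities in coordinates be written with numerals and closed by [ring]. *)
Definition crd n (p : 'rV[C]_n.+1) (i : nat) : C := p 0 (inord i).

Local Arguments crd {n} p i%_N.

Lemma crdD n (p q : 'rV[C]_n.+1) i : crd (p + q) i = crd p i + crd q i.
Proof. by rewrite /crd mxE. Qed.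

Lemma crdZ n a (p : 'rV[C]_n.+1) i : crd (a *: p) i = a * crd p i.
Proof. by rewrite /crd mxE. Qed.

Definition wedge x y : 'rV[C]_6 :=
  \row_m ([:: crd x 0 * crd y 1 - crd x 1 * crd y 0;
             crd x 0 * crd y 2 - crd x 2 * crd y 0;
             crd x 0 * crd y 3 - crd x 3 * crd y 0;
             crd x 1 * crd y 2 - crd x 2 * crd y 1;
             crd x 1 * crd y 3 - crd x 3 * crd y 1;
             crd x 2 * crd y 3 - crd x 3 * crd y 2] : seq C)`_m.

(** The polar form of [quadric]; two lines meet iff it vanishes on their coordinates. *)
Definition pluecker p q : C :=
  crd p 0 * crd q 5 - crd p 1 * crd q 4 + crd p 2 * crd q 3
  + crd p 3 * crd q 2 - crd p 4 * crd q 1 + crd p 5 * crd q 0.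

Definition quadric p : C :=
  crd p 0 * crd p 5 - crd p 1 * crd p 4 + crd p 2 * crd p 3.

(* The i-th row of the skew-symmetric 4 x 4 matrix with Pluecker coordinates p *)
Definition skew_row p (i : nat) : 'rV[C]_4 :=
  \row_j (nth [::] [:: [:: 0; crd p 0; crd p 1; crd p 2];
                       [:: - crd p 0; 0; crd p 3; crd p 4];
                       [:: - crd p 1; - crd p 3; 0; crd p 5];
                       [:: - crd p 2; - crd p 4; - crd p 5; 0]] i)`_j.

Definition pluecker_pair_nat (m : nat) : nat * nat :=
  nth (0, 0)%N [:: (0, 1); (0, 2); (0, 3); (1, 2); (1, 3); (2, 3)]%N m.

Lemma crd_wedge x y :
  (((crd (wedge x y) 0 = crd x 0 * crd y 1 - crd x 1 * crd y 0) *
    (crd (wedge x y) 1 = crd x 0 * crd y 2 - crd x 2 * crd y 0) *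
    (crd (wedge x y) 2 = crd x 0 * crd y 3 - crd x 3 * crd y 0)) *
   ((crd (wedge x y) 3 = crd x 1 * crd y 2 - crd x 2 * crd y 1) *
    (crd (wedge x y) 4 = crd x 1 * crd y 3 - crd x 3 * crd y 1) *
    (crd (wedge x y) 5 = crd x 2 * crd y 3 - crd x 3 * crd y 2)))%type.
Proof. by do ?[split]; rewrite [LHS]mxE inordK. Qed.

Lemma crd_skew_row p :
  let S := skew_row p in
  ((((crd (S 0%N) 0 = 0) * (crd (S 0%N) 1 = crd p 0) *
     (crd (S 0%N) 2 = crd p 1) * (crd (S 0%N) 3 = crd p 2)) *
    ((crd (S 1%N) 0 = - crd p 0) * (crd (S 1%N) 1 = 0) *
     (crd (S 1%N) 2 = crd p 3) * (crd (S 1%N) 3 = crd p 4))) *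
   (((crd (S 2%N) 0 = - crd p 1) * (crd (S 2%N) 1 = - crd p 3) *
     (crd (S 2%N) 2 = 0) * (crd (S 2%N) 3 = crd p 5)) *
    ((crd (S 3%N) 0 = - crd p 2) * (crd (S 3%N) 1 = - crd p 4) *
     (crd (S 3%N) 2 = - crd p 5) * (crd (S 3%N) 3 = 0))))%type.
Proof. by do ?[split]; rewrite [LHS]mxE inordK. Qed.

Lemma rV6P p q : crd p 0 = crd q 0 -> crd p 1 = crd q 1 -> crd p 2 = crd q 2 ->
  crd p 3 = crd q 3 -> crd p 4 = crd q 4 -> crd p 5 = crd q 5 -> p = q.
Proof.
move=> h0 h1 h2 h3 h4 h5; apply/rowP => i; rewrite -(inord_val i).
by case: i => -[|[|[|[|[|[|//]]]]]] ? /=.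
Qed.

(** Polarization of the identity for decomposable bivectors in [wedge_skew_row]. It writes a vector
    tangent to the quadric at a line x /\ y explicitly as x /\ y' + x' /\ y. *)
Lemma wedge_skew_row2 p q m : (m < 6)%N -> pluecker p q = 0 ->
  let i := (pluecker_pair_nat m).1 in let j := (pluecker_pair_nat m).2 in
  wedge (skew_row p i) (skew_row q j) + wedge (skew_row q i) (skew_row p j) =
  crd p m *: q + crd q m *: p.
Proof.
rewrite /pluecker /= => hm h.
have {}h : crd p 0 * crd q 5 = crd p 1 * crd q 4 - crd p 2 * crd q 3
    - crd p 3 * crd q 2 + crd p 4 * crd q 1 - crd p 5 * crd q 0.
  by apply/eqP; rewrite -subr_eq0 -[X in _ == X]h; apply/eqP; ring.
case: m hm => [|[|[|[|[|[|//]]]]]] _ /=;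
apply: rV6P; rewrite !crdD !crdZ !crd_wedge !crd_skew_row; ring: h.
Qed.

(** The rows of the skew matrix of a decomposable bivector lie on its line; rows i and j form a
    basis of it when p_ij is nonzero. *)
Lemma wedge_skew_row p m : (m < 6)%N -> quadric p = 0 ->
  wedge (skew_row p (pluecker_pair_nat m).1) (skew_row p (pluecker_pair_nat m).2) =
  crd p m *: p.
Proof.
rewrite /quadric /= => hm h.
have {}h : crd p 0 * crd p 5 = crd p 1 * crd p 4 - crd p 2 * crd p 3.
  by apply/eqP; rewrite -subr_eq0 -[X in _ == X]h; apply/eqP; ring.
case: m hm => [|[|[|[|[|[|//]]]]]] _ /=;
apply: rV6P; rewrite !crdZ !crd_wedge !crd_skew_row; ring: h.
Qed.

Lemma quadricD p q : quadric (p + q) = quadric p + pluecker p q + quadric q.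
Proof. by rewrite /quadric /pluecker !crdD; ring. Qed.

Lemma quadricZ a p : quadric (a *: p) = a ^+ 2 * quadric p.
Proof. by rewrite /quadric !crdZ; ring. Qed.

Lemma pluecker_linear p q r a : pluecker p (a *: q + r) = a * pluecker p q + pluecker p r.
Proof. by rewrite /pluecker !crdD !crdZ; ring. Qed.

Lemma plueckerC p q : pluecker p q = pluecker q p.
Proof. by rewrite /pluecker; ring. Qed.

Lemma pluecker_self p : pluecker p p = quadric p *+ 2.
Proof. by rewrite /pluecker /quadric; ring. Qed.

Lemma quadric_wedge x y : quadric (wedge x y) = 0.
Proof. by rewrite /quadric !crd_wedge; ring. Qed.

Lemma wedgeC x y : wedge y x = - wedge x y.
Proof.
by rewrite -scaleN1r; apply: rV6P; rewrite !crdZ !crd_wedge; ring.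
Qed.

Lemma wedge_linear x y z a : wedge x (a *: y + z) = a *: wedge x y + wedge x z.
Proof.
by apply: rV6P; rewrite !crdD !crdZ !crd_wedge !crdD !crdZ; ring.
Qed.

Definition rows4 (x y z w : 'rV[C]_4) : 'M[C]_4 :=
  \matrix_(i < 4) nth 0 [:: x; y; z; w] i.

Lemma det_rows4 x y z w : \det (rows4 x y z w) = pluecker (wedge x y) (wedge z w).
Proof.
have -> : rows4 x y z w = \matrix_(i < 4, j < 4) crd (nth 0 [:: x; y; z; w] i) j.
  by apply/matrixP => i j; rewrite !mxE /crd inord_val.
by rewrite (det_matrix4 (fun i j => crd (nth 0 [:: x; y; z; w] i) j)) /pluecker !crd_wedge /=; ring.
Qed.

Lemma sum_ord6 (V : nmodType) (F : 'I_6 -> V) :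
  \sum_(i < 6) F i = F (inord 0) + (F (inord 1) + (F (inord 2) +
    (F (inord 3) + (F (inord 4) + F (inord 5))))).
Proof.
rewrite !big_ord_recl big_ord0 addr0.
by do ?congr (_ + _); congr F; apply: val_inj; rewrite /= inordK.
Qed.

Definition gram6 : 'M[C]_6 := \matrix_(i < 6, j < 6)
  (nth [::] [:: [:: 0; 0; 0; 0; 0; 1]; [:: 0; 0; 0; 0; -1; 0];
                [:: 0; 0; 0; 1; 0; 0]; [:: 0; 0; 1; 0; 0; 0];
                [:: 0; -1; 0; 0; 0; 0]; [:: 1; 0; 0; 0; 0; 0]] i)`_j.

Lemma crd_gram6 p j : (j < 6)%N ->
  crd (p *m gram6) j = ([:: crd p 5; - crd p 4; crd p 3; crd p 2; - crd p 1; crd p 0] : seq C)`_j.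
Proof.
move=> hj; rewrite {1}/crd mxE sum_ord6 !mxE !inordK // -!/(crd p _).
by case: j hj => [|[|[|[|[|[|//]]]]]] _ /=; ring.
Qed.

Lemma gram6_unit : gram6 \in unitmx.
Proof.
rewrite -row_free_unit; apply: row_freeP0 => p h.
have e j : (j < 6)%N -> ([:: crd p 5; - crd p 4; crd p 3; crd p 2; - crd p 1; crd p 0] : seq C)`_j = 0.
  by move=> hj; rewrite -crd_gram6 // h /crd mxE.
have c0 j : crd (0 : 'rV[C]_6) j = 0 by rewrite /crd mxE.
by apply: rV6P; rewrite c0; [have := e 5|have := e 4|have := e 3|have := e 2
  |have := e 1|have := e 0]; move=> /(_ isT) /= /eqP; rewrite ?oppr_eq0 => /eqP.
Qed.

Lemma pluecker_gram6 p q : p *m gram6 *m q^T = (pluecker p q)%:M.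
Proof.
have tq m : q^T m 0 = q 0 m by rewrite mxE.
apply/matrixP => i j; rewrite !ord1 [LHS]mxE sum_ord6 [RHS]mxE eqxx mulr1n !tq.
rewrite -!/(crd (p *m gram6) _) !crd_gram6 //= -!/(crd q _) /pluecker.
by ring.
Qed.

End Pluecker.

(** * Pencils of bivectors satisfying the equations of Z_k *)

Section JumpingPencil.
Variables (C : numClosedFieldType) (k : nat).
Variables (J : 'M[C]_(k.+1 * 2)) (A : 'I_4 -> 'M[C]_(k, k.+1 * 2)).

Definition jump_lin (p : 'rV[C]_6) : 'M[C]_k :=
  \sum_(m < 6) p 0 m *:
    (A (tnth plucker_pair m).1 *m J *m (A (tnth plucker_pair m).2)^T).

Lemma jump_linD p q : jump_lin (p + q) = jump_lin p + jump_lin q.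
Proof. by rewrite -big_split; apply: eq_bigr => m _; rewrite mxE scalerDl. Qed.

Lemma jump_linZ a p : jump_lin (a *: p) = a *: jump_lin p.
Proof. by rewrite scaler_sumr; apply: eq_bigr => m _; rewrite mxE scalerA. Qed.

Lemma tnth_plucker_pair m : (m < 6)%N ->
  tnth plucker_pair (inord m) =
  (inord (pluecker_pair_nat m).1, inord (pluecker_pair_nat m).2).
Proof.
move=> hm; rewrite (tnth_nth 0) inordK //.
by case: m hm => [|[|[|[|[|[|//]]]]]] _ /=; congr pair; apply: val_inj; rewrite /= inordK.
Qed.

Lemma row4_delta (x : 'rV[C]_4) :
  x = crd x 0 *: delta_mx 0 (inord 0) + crd x 1 *: delta_mx 0 (inord 1)
    + crd x 2 *: delta_mx 0 (inord 2) + crd x 3 *: delta_mx 0 (inord 3).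
Proof.
rewrite {1}[x]row_sum_delta !big_ord_recl big_ord0 addr0 !addrA.
by do ?congr (_ + _); congr (x 0 _ *: delta_mx 0 _); apply: val_inj; rewrite /= inordK.
Qed.

Hypothesis monadA : monad J A.

(** [jump_mx] is bilinear and alternating, so it factors through bivectors; the factorization is the
    linear system defining Z_k. *)
Lemma jump_lin_wedge x y : jump_lin (wedge x y) = jump_mx J A x y.
Proof.
pose d i : 'rV[C]_4 := delta_mx 0 (inord i).
have B m : (m < 6)%N -> (wedge x y) 0 (inord m) *:
    (A (tnth plucker_pair (inord m)).1 *m J *m (A (tnth plucker_pair (inord m)).2)^T) =
    crd (wedge x y) m *: jump_mx J A (d (pluecker_pair_nat m).1) (d (pluecker_pair_nat m).2).
  by move=> hm; rewrite tnth_plucker_pair // /jump_mx !monad_map_delta.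
rewrite /jump_lin sum_ord6 !B // !crd_wedge.
have -> : jump_mx J A x y = jump_mx J A
    (crd x 0 *: d 0%N + crd x 1 *: d 1%N + crd x 2 *: d 2%N + crd x 3 *: d 3%N)
    (crd y 0 *: d 0%N + crd y 1 *: d 1%N + crd y 2 *: d 2%N + crd y 3 *: d 3%N).
  by rewrite -!row4_delta.
rewrite [pluecker_pair_nat 0]/= [pluecker_pair_nat 1]/= [pluecker_pair_nat 2]/=.
rewrite [pluecker_pair_nat 3]/= [pluecker_pair_nat 4]/= [pluecker_pair_nat 5]/=.
move: (crd x) (crd y) => {x y B} x y.
have C10 := jump_mxC monadA (d 0%N) (d 1%N).
have C20 := jump_mxC monadA (d 0%N) (d 2%N).
have C30 := jump_mxC monadA (d 0%N) (d 3%N).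
have C21 := jump_mxC monadA (d 1%N) (d 2%N).
have C31 := jump_mxC monadA (d 1%N) (d 3%N).
have C32 := jump_mxC monadA (d 2%N) (d 3%N).
rewrite !(jump_mxDl, jump_mxDr, jump_mxZl, jump_mxZr) !(jump_mxx monadA).
rewrite {}C10 {}C20 {}C30 {}C21 {}C31 {}C32.
move: (jump_mx J A (d 0%N) (d 1%N)) (jump_mx J A (d 0%N) (d 2%N))
  (jump_mx J A (d 0%N) (d 3%N)) (jump_mx J A (d 1%N) (d 2%N))
  (jump_mx J A (d 1%N) (d 3%N)) (jump_mx J A (d 2%N) (d 3%N)) => ??????.
apply/matrixP => a b; rewrite !mxE; ring.
Qed.

Definition mk_line (x y : 'rV[C]_4) : 'M[C]_(2, 2 * 2) :=
  \matrix_(i < 2) (if i == 0 then x else y).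

Lemma row_mk_line0 x y : row 0 (mk_line x y) = x.
Proof. by rewrite rowK. Qed.

Lemma row_mk_line1 x y : row 1 (mk_line x y) = y.
Proof. by rewrite rowK. Qed.

Lemma mk_line_full x y z w : pluecker (wedge x y) (wedge z w) != 0 ->
  (1%:M <= mk_line x y + mk_line z w)%MS.
Proof.
rewrite -det_rows4 -unitfE -unitmxE -row_full_unit -sub1mx => h.
apply: submx_trans h _; apply/row_subP => i; rewrite rowK.
have h0 : (x <= mk_line x y + mk_line z w)%MS.
  by apply: submx_trans (addsmxSl _ _); rewrite -{1}(row_mk_line0 x y) row_sub.
have h1 : (y <= mk_line x y + mk_line z w)%MS.
  by apply: submx_trans (addsmxSl _ _); rewrite -{1}(row_mk_line1 x y) row_sub.
have h2 : (z <= mk_line x y + mk_line z w)%MS.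
  by apply: submx_trans (addsmxSr _ _); rewrite -{1}(row_mk_line0 z w) row_sub.
have h3 : (w <= mk_line x y + mk_line z w)%MS.
  by apply: submx_trans (addsmxSr _ _); rewrite -{1}(row_mk_line1 z w) row_sub.
by case: i => -[|[|[|[|//]]]].
Qed.

Lemma nonzero_crd (p : 'rV[C]_6) : p != 0 -> exists2 m, (m < 6)%N & crd p m != 0.
Proof. by case/rV0Pn => i pi; exists i; rewrite // /crd inord_val. Qed.

Lemma isotropic_wedge (p : 'rV[C]_6) : p != 0 -> quadric p = 0 ->
  exists2 m, (m < 6)%N & crd p m != 0 /\
    wedge (skew_row p (pluecker_pair_nat m).1) (skew_row p (pluecker_pair_nat m).2)
    = crd p m *: p.
Proof.
by move=> /nonzero_crd[m hm pm] q0; exists m => //; split=> //; apply: wedge_skew_row.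
Qed.

Lemma wedge_pencil_point (x y : 'rV[C]_4) a b :
  wedge x y != 0 -> (a, b) != (0, 0) ->
  exists v s, s != 0 /\ wedge (a *: x + b *: y) v = s *: wedge x y.
Proof.
move=> xy ab; have [a0|a0] := eqVneq a 0; last first.
  exists y, a; split=> //.
  by apply: rV6P; rewrite !crdZ !crd_wedge !crdD !crdZ; ring.
exists x, (- b); split; first by move: ab; rewrite a0 xpair_eqE eqxx oppr_eq0.
by apply: rV6P; rewrite a0 !crdZ !crd_wedge !crdD !crdZ; ring.
Qed.

Lemma crd0 n i : crd (0 : 'rV[C]_n.+1) i = 0.
Proof. by rewrite /crd mxE. Qed.

Lemma wedge0l (x : 'rV[C]_4) : wedge 0 x = 0.
Proof. by apply: rV6P; rewrite !crd_wedge !crd0; ring. Qed.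

Lemma wedgexx (x : 'rV[C]_4) : wedge x x = 0.
Proof. by apply: rV6P; rewrite !crd_wedge !crd0; ring. Qed.

Lemma plueckerZ a b (p q : 'rV[C]_6) :
  pluecker (a *: p) (b *: q) = a * b * pluecker p q.
Proof. by rewrite /pluecker !crdZ; ring. Qed.

Lemma wedge_indep (x y : 'rV[C]_4) a b :
  wedge x y != 0 -> a *: x + b *: y = 0 -> (a, b) = (0, 0).
Proof.
move=> xy e; apply/eqP; apply: contraT => ab.
have [v [s [s0]]] := wedge_pencil_point xy ab.
by rewrite e wedge0l => /esym/eqP; rewrite scaler_eq0 (negPf s0) (negPf xy).
Qed.

(** Here [p] and [q] are lines that meet in a point u, so they can be written u /\ v1 and u /\ w1 up
    to scalars; independence of p and q makes u, v1, w1 independent. *)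
Lemma isotropic_pencil_absurd (p q : 'rV[C]_6) :
  (1 < k)%N -> (forall a b, (a, b) != (0, 0) -> a *: p + b *: q != 0) ->
  quadric p = 0 -> quadric q = 0 -> pluecker p q = 0 ->
  jump_lin p = 0 -> jump_lin q = 0 -> False.
Proof.
move=> k1 indep Qp Qq Bpq jp jq.
have p0 : p != 0.
  by have := indep 1 0; rewrite scale1r scale0r addr0; apply; rewrite xpair_eqE oner_eq0.
have q0 : q != 0.
  by have := indep 0 1; rewrite scale1r scale0r add0r; apply; rewrite xpair_eqE oner_eq0 andbF.
have [m _ [pm]] := isotropic_wedge p0 Qp.
set x := skew_row p _; set y := skew_row p _ => xy.
have [n _ [qn]] := isotropic_wedge q0 Qq.
set z := skew_row q _; set w := skew_row q _ => zw.
have xy0 : wedge x y != 0 by rewrite xy scaler_eq0 negb_or pm.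
have zw0 : wedge z w != 0 by rewrite zw scaler_eq0 negb_or qn.
(* The determinant of the four spanning points is the Pluecker pairing, and a linear dependence
   between them gives the common point. *)
have /eqP/det0P[v v0 vD] : \det (rows4 x y z w) = 0.
  by rewrite det_rows4 xy zw plueckerZ Bpq mulr0.
have {vD} dep : crd v 0 *: x + crd v 1 *: y = - (crd v 2 *: z + crd v 3 *: w).
  apply/eqP; rewrite -addr_eq0 addrA; apply/eqP; rewrite -[RHS]vD mulmx_sum_row.
  rewrite !big_ord_recl big_ord0 addr0 !rowK /= !addrA.
  by do ?congr (_ + _); congr (v 0 _ *: _); apply: val_inj; rewrite /= inordK.
have crd_v0 : (forall i, (i < 4)%N -> crd v i = 0) -> False.
  by move=> h; case/rV0Pn: v0 => i; rewrite -(inord_val i) -/(crd v i) h ?eqxx.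
have ab0 : (crd v 0, crd v 1) != (0, 0).
  apply/eqP => -[e0 e1]; apply: crd_v0; move: dep.
  rewrite e0 e1 !scale0r addr0 => /esym/eqP; rewrite oppr_eq0 => /eqP.
  by move/(wedge_indep zw0) => [e2 e3] [|[|[|[|//]]]].
have cd0 : (crd v 2, crd v 3) != (0, 0).
  apply/eqP => -[e2 e3]; move: dep.
  rewrite e2 e3 !scale0r addr0 oppr0 => /(wedge_indep xy0) e.
  by move/eqP: ab0; apply.
set u := crd v 0 *: x + crd v 1 *: y in dep.
have [v1 [s [s0 uv1]]] := wedge_pencil_point xy0 ab0.
have [w1 [t [t0 uw1]]] := wedge_pencil_point zw0 cd0.
rewrite -/u xy scalerA in uv1.
have {}uw1 : wedge u w1 = - (t * crd q n) *: q.
  rewrite dep -scaleN1r wedgeC -[_ *: _]addr0 wedge_linear wedgeC uw1 zw.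
  by rewrite wedgeC wedge0l oppr0 addr0 scaleN1r opprK scalerA scaleNr.
clearbody u; apply: (@meeting_lines_absurd _ k J A u v1 w1) => //.
- move=> a b c; apply: contraNneq => e.
  have : wedge u (a *: u + (b *: v1 + (c *: w1 + 0))) = 0.
    by rewrite addr0 addrA e wedgeC wedge0l oppr0.
  rewrite !wedge_linear uv1 uw1 !scalerA.
  rewrite wedgexx scaler0 add0r wedgeC wedge0l oppr0 addr0 => e'.
  have : (b * (s * crd p m), c * - (t * crd q n)) = (0, 0).
    by apply/eqP; apply: contraT => /indep; rewrite e' eqxx.
  case=> /eqP; rewrite !mulf_eq0 (negPf s0) (negPf pm) !orbF => /eqP b0.
  move=> /eqP; rewrite mulf_eq0 oppr_eq0 mulf_eq0 (negPf t0) (negPf qn) !orbF => /eqP c0.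
  move: e; rewrite b0 c0 !scale0r !addr0 => /eqP; rewrite scaler_eq0 => /orP[/eqP ->//|/eqP u0].
  by move: uv1; rewrite u0 wedge0l => /esym/eqP; rewrite scaler_eq0 mulf_eq0
    (negPf s0) (negPf pm) (negPf p0).
- by rewrite -jump_lin_wedge // uv1 jump_linZ jp scaler0.
by rewrite -jump_lin_wedge // uw1 jump_linZ jq scaler0.
Qed.

End JumpingPencil.

Lemma plueckerZr (C : fieldType) a (p q : 'rV[C]_6) :
  pluecker p (a *: q) = a * pluecker p q.
Proof. by rewrite /pluecker !crdZ; ring. Qed.

Lemma anisotropic_pencil_fine_action (C : numClosedFieldType) (k : nat)
    (J : 'M[C]_(k.+1 * 2)) (A : 'I_4 -> 'M[C]_(k, k.+1 * 2))
    (E : bundle_data C 2) (p q : 'rV[C]_6) :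
  (0 < k)%N -> is_bundle E -> h0_eq E 0 0 -> represents J A E ->
  (forall a b, (a, b) != (0, 0) -> a *: p + b *: q != 0) ->
  quadric p != 0 -> jump_lin J A p = 0 -> jump_lin J A q = 0 ->
  exists G : 'M[C]_4 -> Prop,
    [/\ closed_subgroup G, forall g, G g -> Sym0 E g, positive_dim G
      & fine_action k E G].
Proof.
move=> k0 bE h0 repA indep Qp jp jq0; have monadA := repA.1.
have spanA (w : 'cV_(k.+1 * 2)) : (forall i, A i *m w = 0) -> w = 0 by exact: monad_span bE h0 repA.
have [c Qc] : exists c, quadric (q + c *: p) = 0.
  (* The quadric restricted to the pencil; its leading coefficient is nonzero as [p] is off the
     quadric, so it has a root. *)
  pose P : {poly C} := (quadric p)%:P * 'X^2 + (pluecker q p)%:P * 'X + (quadric q)%:P.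
  have : size P != 1%N.
    apply: contraNneq Qp => sP; have : P`_2 = 0 by apply: nth_default; rewrite sP.
    by rewrite /P !coefD !coefCM coefXn coefX coefC /= mulr1 mulr0 !addr0 => ->.
  move=> /closed_rootP[c /rootP rc]; exists c; rewrite -[RHS]rc.
  rewrite quadricD quadricZ plueckerZr /P !(hornerD, hornerM, hornerC, hornerX, hornerXn).
  by ring.
pose r := q + c *: p.
have r0 : r != 0.
  by have := indep c 1; rewrite scale1r addrC; apply; rewrite xpair_eqE oner_eq0 andbF.
have jr : jump_lin J A r = 0 by rewrite jump_linD jump_linZ jp jq0 scaler0 addr0.
have [m hm [rm rm0]] := isotropic_wedge r0 Qc.
have /= := @wedge_skew_row2 _ r p m hm; move: rm0.
set x := skew_row r (pluecker_pair_nat m).1.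
set y := skew_row r (pluecker_pair_nat m).2.
set x' := skew_row p (pluecker_pair_nat m).1.
set y' := skew_row p (pluecker_pair_nat m).2 => xy skew2.
have jxy : jump_mx J A x y = 0 by rewrite -jump_lin_wedge // xy jump_linZ jr scaler0.
(* The pencil touches the quadric at [r] iff this pairing vanishes. *)
have [Brp|Brp] := eqVneq (pluecker r p) 0.
  move: skew2 => /(_ Brp) skew2.
  pose L (j : 'I_2) := if j == 0 then mk_line x' y' else mk_line x y.
  have full : (1%:M <= L 0 + L 1)%MS.
    rewrite addsmxC; apply: mk_line_full.
    (* On a sum of two decomposable bivectors the quadric is their pairing; exchanging y and y'
       changes it only by a sign, so x, y, x', y' are a basis. *)
    have : quadric (wedge x y' + wedge x' y) != 0.
      rewrite skew2 quadricD !quadricZ Qc plueckerZ plueckerC Brp !mulr0 !addr0.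
      by rewrite mulf_neq0 // expf_neq0.
    apply: contraNneq => e; apply/eqP; rewrite quadricD !quadric_wedge add0r addr0.
    by rewrite -[RHS]oppr0 -[in RHS]e /pluecker !crd_wedge; ring.
  apply: (double_line_fine_action monadA spanA bE repA full k0);
    rewrite /L /= !(row_mk_line0, row_mk_line1) //.
  rewrite -!jump_lin_wedge // -jump_linD skew2 jump_linD !jump_linZ jp jr.
  by rewrite !scaler0 addr0.
(* The second intersection of the pencil with the quadric. *)
pose s := p - (quadric p / pluecker r p) *: r.
have Qs : quadric s = 0.
  rewrite /s quadricD -scaleNr quadricZ Qc mulr0 addr0 plueckerZr.
  by rewrite (plueckerC p) mulNr mulfVK // subrr.
have Brs : pluecker r s != 0.
  rewrite /s addrC -scaleNr pluecker_linear pluecker_self Qc mul0rn mulr0 add0r.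
  exact: Brp.
have s0 : s != 0.
  apply: contraNneq Brs => ->; rewrite /pluecker !crd0; apply/eqP; ring.
have js : jump_lin J A s = 0.
  by rewrite /s -scaleNr jump_linD jump_linZ jp jr scaler0 addr0.
have [n hn [sn]] := isotropic_wedge s0 Qs.
set z := skew_row s _; set w := skew_row s _ => zw.
have jzw : jump_mx J A z w = 0 by rewrite -jump_lin_wedge // zw jump_linZ js scaler0.
pose L (j : 'I_2) := if j == 0 then mk_line x y else mk_line z w.
have full : (1%:M <= L 0 + L 1)%MS.
  by apply: mk_line_full; rewrite xy zw plueckerZ !mulf_neq0.
apply: (skew_lines_fine_action monadA spanA bE repA full).
by elim/ord2P; rewrite /L /= !(row_mk_line0, row_mk_line1).
Qed.

(** * The ideal of Z_k *)

(** Double annihilator: the column space of [F] lies in the annihilator of the left kernel, and the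
    dimensions agree. *)
Lemma sub_annihilator (C : fieldType) (m n : nat) (F : 'M[C]_(m, n)) (c : 'cV[C]_m) :
  kermx F *m c = 0 -> exists d : 'cV_n, c = F *m d.
Proof.
move=> kc.
have sF : (F^T <= kermx (kermx F)^T)%MS.
  by apply/sub_kermxP; rewrite -trmx_mul mulmx_ker trmx0.
have : (kermx (kermx F)^T <= F^T)%MS.
  rewrite -(mxrank_leqif_sup sF) mxrank_ker !mxrank_tr mxrank_ker.
  by rewrite subKn ?rank_leq_row.
have : (c^T <= kermx (kermx F)^T)%MS.
  by apply/sub_kermxP; rewrite -trmx_mul kc trmx0.
move=> h1 h2; have /submxP[D /(congr1 trmx)] := submx_trans h1 h2.
by rewrite trmxK trmx_mul trmxK => ->; exists D^T.
Qed.

Lemma comp_mpoly_scale (C : fieldType) (n d : nat) (f l : {mpoly C[n]}) (g : 'I_n -> C) :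
  f \is d.-homog -> f \mPo [tuple g i *: l | i < n] = f.@[g] *: l ^+ d.
Proof.
move=> hf; rewrite comp_mpolyEX mevalE scaler_suml !big_seq; apply: eq_bigr => m hm.
rewrite comp_mpolyX -scalerA; congr (_ *: _).
rewrite (eq_bigr (fun i => g i ^+ m i *: l ^+ m i)); last first.
  by move=> i _; rewrite tnth_mktuple exprZn.
rewrite scaler_prod; congr (_ *: _).
have <- : mdeg m = d by apply: (dhomog_mf hf).
by rewrite mdegE expr_sum.
Qed.

Definition mpoly_ideal (C : fieldType) (n : nat) (I : {mpoly C[n]} -> Prop) : Prop :=
  [/\ I 0, forall p q, I p -> I q -> I (p + q) & forall p q, I q -> I (p * q)].

Lemma mpoly_ideal_comp (C : fieldType) (n : nat) (I : {mpoly C[n]} -> Prop)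
    (lq : n.-tuple {mpoly C[n]}) :
  mpoly_ideal I -> (forall i, I ('X_i - tnth lq i)) ->
  forall f, I (f - (f \mPo lq)).
Proof.
move=> [I0 ID IM] IX; elim/mpoly_ring_ind => [c|i|p q Ip Iq|p q Ip Iq].
- by rewrite comp_mpolyC subrr.
- by rewrite comp_mpolyXU -tnth_nth.
- by rewrite comp_mpolyD opprD addrACA; apply: ID.
rewrite rmorphM /=.
have -> : p * q - ((p \mPo lq) * (q \mPo lq)) =
    q * (p - (p \mPo lq)) + (p \mPo lq) * (q - (q \mPo lq)) by ring.
by apply: ID; apply: IM.
Qed.

(* If the linear forms with coefficients the columns of F have at most one
   common zero g in the projective space, then modulo these forms every
   coordinate is a multiple of one linear form, hence so is every homogeneous
   polynomial of degree d of the d-th power of that form. *)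
Lemma length_linear_ideal (C : fieldType) (n N : nat) (F : 'M[C]_(n, N))
    (I : {mpoly C[n]} -> Prop) :
  mpoly_ideal I -> (forall j, I (\sum_(m < n) F m j *: 'X_m)) ->
  length_ge I 2 -> (1 < \rank (kermx F))%N.
Proof.
move=> idI IF [d0 /(_ d0 (leqnn _)) [f [hf ind]]].
have [I0 ID IM] := idI.
rewrite ltnNge; apply/negP => /rank_le1[g /submxP[D kD]].
have IZ c p : I p -> I (c *: p) by rewrite -mul_mpolyC; apply: IM.
have Isum (T : finType) (h : T -> {mpoly C[n]}) : (forall t, I (h t)) -> I (\sum_t h t).
  by move=> hh; apply: big_ind => // t _; apply: hh.
(* [e] is dual to [g], so the form l takes the value 1 at g. If [g = 0], then l = 0 and every
   variable lies in I. *)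
have [e ge] : exists e : 'cV[C]_n, g *m e *m g = g.
  have [->|/rV0Pn[i gi]] := eqVneq g 0; first by exists 0; rewrite mulmx0.
  exists ((g 0 i)^-1 *: delta_mx i 0); rewrite -scalemxAr -colE.
  have -> : col i g = (g 0 i)%:M by apply/matrixP => a b; rewrite !ord1 !mxE.
  by rewrite -scalemxAl mul_scalar_mx scalerA mulVf // scale1r.
pose l : {mpoly C[n]} := \sum_m e m 0 *: 'X_m.
have Ilin (c : 'cV[C]_n) : kermx F *m c = 0 -> I (\sum_m c m 0 *: 'X_m).
  move=> /sub_annihilator[d ->].
  have -> : \sum_m (F *m d) m 0 *: 'X_m =
      \sum_j d j 0 *: (\sum_m F m j *: 'X_m) :> {mpoly C[n]}.
    under [RHS]eq_bigr do rewrite scaler_sumr.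
    rewrite exchange_big; apply: eq_bigr => m _; rewrite mxE scaler_suml.
    by apply: eq_bigr => j _; rewrite scalerA mulrC.
  by apply: Isum => j; apply/IZ/IF.
pose lq := [tuple g 0 i *: l | i < n].
have Iq i : I ('X_i - tnth lq i).
  have := Ilin (delta_mx i 0 - g 0 i *: e).
  rewrite kD mulmxBr -scalemxAr -!mulmxA.
  have -> : g *m delta_mx i 0 = g 0 i *: (g *m e).
    rewrite -{1}ge -mulmxA -colE [col i g](_ : _ = (g 0 i)%:M) ?mul_mx_scalar //.
    by apply/matrixP => a b; rewrite !ord1 !mxE.
  rewrite -scalemxAr subrr => /(_ erefl).
  under eq_bigr do rewrite !mxE andbT scalerBl.
  rewrite big_split /= (bigD1 i) //= eqxx scale1r big1 ?addr0 => [|m /negPf -> //]; last exact: scale0r.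
  rewrite tnth_mktuple scaler_sumr -sumrN.
  by under [X in _ -> I (_ + X)]eq_bigr do rewrite scalerA.
have If j : I (f j - (f j).@[g 0] *: l ^+ d0).
  by rewrite -comp_mpoly_scale //; apply: mpoly_ideal_comp.
have comb c : \sum_(j < 2) c j * (f j).@[g 0] = 0 -> forall j, c j = 0.
  move=> hc; apply: ind.
  have -> : \sum_(j < 2) c j *: f j = \sum_(j < 2) c j *: (f j - (f j).@[g 0] *: l ^+ d0).
    under [RHS]eq_bigr do rewrite scalerBr scalerA.
    by rewrite big_split /= sumrN -scaler_suml hc scale0r subr0.
  by apply: Isum => j; apply/IZ/If.
pose v j := (f j).@[g 0].
(* The relation between two scalars: v 1 f 0 - v 0 f 1 lies in I, so both values vanish, and then f
   0 + f 1 lies in I as well. *)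
have := comb (fun j => if j == 0 then v 1 else - v 0).
rewrite !big_ord_recl big_ord0 addr0 lift01 /= -!/(v _) mulNr mulrC subrr => /(_ erefl) hv.
have v1 : v 1 = 0 := hv 0.
have v0 : v 0 = 0 by apply/eqP; rewrite -oppr_eq0; apply/eqP; apply: (hv 1).
have /(_ _ 0) := comb (fun=> 1); rewrite !big_ord_recl big_ord0 addr0 lift01 -!/(v _) v0 v1.
by rewrite !mulr0 addr0 => /(_ erefl)/eqP; rewrite oner_eq0.
Qed.

Lemma Zk_ideal_ideal (C : fieldType) (k : nat) (J : 'M[C]_(k.+1 * 2))
    (A : 'I_4 -> 'M[C]_(k, k.+1 * 2)) : mpoly_ideal (Zk_ideal J A).
Proof.
split.
- exists 0, (fun _ _ => 0); rewrite mul0r add0r big1 // => a _.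
  by rewrite big1 // => b _; rewrite mul0r.
- move=> _ _ [q [h ->]] [q' [h' ->]]; exists (q + q'), (fun a b => h a b + h' a b).
  rewrite mulrDl addrACA; congr (_ + _); rewrite -big_split; apply: eq_bigr => a _.
  by rewrite -big_split; apply: eq_bigr => b _; rewrite mulrDl.
move=> p _ [q [h ->]]; exists (p * q), (fun a b => p * h a b).
rewrite mulrDr mulrA mulr_sumr; congr (_ + _); apply: eq_bigr => a _.
by rewrite mulr_sumr; apply: eq_bigr => b _; rewrite mulrA.
Qed.

(** Its left kernel is the space of bivectors on which all the linear equations vanish. *)
Definition jump_coef_mx (C : fieldType) (k : nat) (J : 'M[C]_(k.+1 * 2))
    (A : 'I_4 -> 'M[C]_(k, k.+1 * 2)) : 'M[C]_(6, k * k) :=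
  \matrix_m mxvec (A (tnth plucker_pair m).1 *m J *m (A (tnth plucker_pair m).2)^T).

Lemma Zk_ideal_forms (C : fieldType) (k : nat) (J : 'M[C]_(k.+1 * 2))
    (A : 'I_4 -> 'M[C]_(k, k.+1 * 2)) j :
  Zk_ideal J A (\sum_(m < 6) jump_coef_mx J A m j *: 'X_m).
Proof.
case/mxvec_indexP: j => a b.
exists 0, (fun a' b' => if (a' == a) && (b' == b) then 1 else 0).
rewrite mul0r add0r (bigD1 a) //= (bigD1 b) //= !eqxx mul1r.
rewrite [X in _ + X + _]big1 ?addr0 => [|b' /negPf ->]; last by rewrite andbF mul0r.
rewrite [X in _ + X]big1 ?addr0 => [|a' /negPf ->]; last by rewrite big1 // => b' _; rewrite mul0r.
by apply: eq_bigr => m _; rewrite mxE mxvecE.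
Qed.

Lemma jump_coef_ker (C : numClosedFieldType) (k : nat) (J : 'M[C]_(k.+1 * 2))
    (A : 'I_4 -> 'M[C]_(k, k.+1 * 2)) (p : 'rV[C]_6) :
  (p <= kermx (jump_coef_mx J A))%MS -> jump_lin J A p = 0.
Proof.
move/sub_kermxP; rewrite mulmx_sum_row => e.
apply: (can_inj mxvecK); rewrite linear0 -[RHS]e linear_sum; apply: eq_bigr => m _.
by rewrite linearZ rowK.
Qed.

(** * Choice of a pencil among the bivectors killed by the equations *)

Local Open Scope complex_scope.

Lemma independent_row (C : fieldType) (m n : nat) (K : 'M[C]_(m, n)) (p : 'rV[C]_n) :
  (1 < \rank K)%N -> p != 0 ->
  exists2 q : 'rV_n, (q <= K)%MS &
    forall a b, (a, b) != (0, 0) -> a *: p + b *: q != 0.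
Proof.
move=> rk p0; have : ~~ (K <= p)%MS.
  by apply/negP => /mxrankS h; have := leq_trans rk (leq_trans h (rank_leq_row p)).
move=> /row_subPn[i Kp]; exists (row i K); first exact: row_sub.
move=> a b; apply: contraNneq => e; have [b0|b0] := eqVneq b 0.
  move: e; rewrite b0 scale0r addr0 => /eqP.
  by rewrite scaler_eq0 (negPf p0) orbF => /eqP ->.
case/negP: Kp; rewrite -(eqmx_scale _ b0).
move/eqP: e; rewrite addrC addr_eq0 => /eqP ->.
by rewrite eqmx_opp scalemx_sub.
Qed.

Theorem theoremB (R : realType) (k : nat) (hk : (1 <= k)%N)
    (E : bundle_data R[i] 2) (hE : instanton k E)
    (hZ : length_Zk_ge k E 2) :
  exists G : 'M[R[i]]_4 -> Prop,
    [/\ closed_subgroup G, forall g, G g -> Sym0 E g, positive_dim G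
      & fine_action k E G].
Proof.
have [J [A [repA lenZ]]] := hZ; have monadA := repA.1.
have rk := length_linear_ideal (Zk_ideal_ideal J A) (Zk_ideal_forms J A) lenZ.
set K := kermx _ in rk; have jK p : (p <= K)%MS -> jump_lin J A p = 0.
  exact: jump_coef_ker.
have [[p pK Qp]|isoK] := boolp.EM (exists2 p : 'rV_6, (p <= K)%MS & quadric p != 0).
  have p0 : p != 0.
    by apply: contraNneq Qp => ->; rewrite /quadric !crd0 !mul0r subrr addr0.
  have [q qK indep] := independent_row rk p0.
  by apply: (anisotropic_pencil_fine_action hk (instanton_bundle hE)
    (instanton_h0 hE) repA indep Qp); apply: jK.
exfalso; have QK (p : 'rV_6) : (p <= K)%MS -> quadric p = 0.
  by move=> pK; apply/eqP; apply: contraT => Qp; case: isoK; exists p.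
have BK (p q : 'rV_6) : (p <= K)%MS -> (q <= K)%MS -> pluecker p q = 0.
  move=> pK qK; have := QK _ (addmx_sub pK qK).
  by rewrite quadricD !QK // add0r addr0.
have [k1|k1] := leqP k 1.
  (* For k = 1 there is one equation, so K has rank at least 5; an isotropic subspace for the
     nondegenerate Pluecker form has rank at most 3. *)
  have isoG : K *m gram6 _ *m K^T = 0.
    apply/matrixP => i j.
    transitivity ((row i K *m gram6 _ *m (row j K)^T) 0 0).
      rewrite [LHS]mxE [RHS]mxE; apply: eq_bigr => l _.
      by rewrite -row_mul [row _ _ 0 l]mxE [K^T l j]mxE [(row j K)^T l 0]mxE [row j K 0 l]mxE.
    by rewrite pluecker_gram6 BK ?row_sub // !mxE mul0rn.
  have := isotropic_rank (gram6_unit _) isoG.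
  rewrite mxrank_ker; have := rank_leq_col (jump_coef_mx J A).
  have : (k * k <= 1)%N by rewrite (leq_mul k1 k1).
  by lia.
have [p0 pK0 pK] : exists2 p : 'rV_6, p != 0 & (p <= K)%MS.
  have /rowV0Pn[p pK p0] : K != 0 by rewrite -mxrank_eq0; case: (\rank K) rk.
  by exists p.
have [q qK indep] := independent_row rk pK0.
by apply: (isotropic_pencil_absurd monadA k1 indep); auto.
Qed.
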